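(* Fix $\tau\in[0,T]$ and let $\bar z(\cdot)=(\bar x(\cdot),\bar u(\cdot),\bar b(\cdot))\in W^{1,2}([0,T];\mathbb{R}^{n+nm+m})$ be a feasible solution to problem $(P^\tau)$. Let $\Delta_k=\{0=t_0^k<t_1^k<\ldots<t_k^k=T\}$ be the uniform partitions with $h_k:=t_{j+1}^k-t_j^k\downarrow 0$ as $k\to\infty$. Assume that $\bar z(\cdot)$ satisfies the following properties at the mesh points (all of which hold automatically if, e.g., $\bar z(\cdot)\in W^{2,\infty}[0,T]$): for each $k\in\mathbb{N}$ the inclusion $\dot{\bar x}(t_j^k)\in F(\bar z(t_j^k))$ holds for all $j=0,\ldots,k-1$; $$\sum_{j=0}^{k-1}h_k\Big\|\frac{\bar x(t_{j+1}^k)-\bar x(t_j^k)}{h_k}-\dot{\bar x}(t_j^k)\Big\|^2\to 0\ \text{ as } k\to\infty;$$ and there is a constant $M>0$ independent of $k$ such that for all $k\in\mathbb{N}$ $$\sum_{j=0}^{k-1}\Big\|\frac{\bar x(t_{j+1}^k)-\bar x(t_j^k)}{h_k}-\dot{\bar x}(t_j^k)\Big\|\le M,\quad \Big\|\frac{\bar u(t_1^k)-\bar u(t_0^k)}{h_k}\Big\|\le M,\quad \Big\|\frac{\bar b(t_1^k)-\bar b(t_0^k)}{h_k}\Big\|\le M,$$ $$\sum_{j=0}^{k-2}\Big\|\frac{\bar u(t_{j+2}^k)-2\bar u(t_{j+1}^k)+\bar u(t_j^k)}{h_k}\Big\|\le M,\quad \sum_{j=0}^{k-2}\Big\|\frac{\bar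 b(t_{j+2}^k)-2\bar b(t_{j+1}^k)+\bar b(t_j^k)}{h_k}\Big\|\le M.$$ Then there is a sequence of functions $z^k(t)=(x^k(t),u^k(t),b^k(t))$ on $[0,T]$, piecewise linear with respect to $\Delta_k$, with $(x^k(0),u^k(0),b^k(0))=(x_0,\bar u(0),\bar b(0))$, such that for all $k\in\mathbb{N}$ and $i=1,\ldots,m$ $$\|u_i^k(t_j^k)\|=1\ \text{ for } j=j_\tau(k),\ldots,j^\tau(k),\qquad \tfrac12\le\|u_i^k(t_j^k)\|\le\tfrac32\ \text{ for } j\le j_\tau(k)-1\text{ and } j\ge j^\tau(k)+1,$$ $$x^k(t)=x^k(t_j^k)+(t-t_j^k)v_j^k\ \text{ for } t_j^k\le t\le t_{j+1}^k\ \text{ with some } v_j^k\in F(z^k(t_j^k)),\quad j=0,\ldots,k-1,$$ and such that $z^k(\cdot)\to\bar z(\cdot)$ in the norm of $W^{1,2}[0,T]$, i.e., $z^k(t)\to\bar z(t)$ uniformly on $[0,T]$ and $\int_0^T\|\dot z^k(t)-\dot{\bar z}(t)\|^2dt\to 0$ as $k\to\infty$. Moreover, there is a constant $\tilde M\ge M$, depending only on $M$ and on the total variation of $\bar u(\cdot)$ on $[0,T]$, such that for every $k\in\mathbb{N}$ $$\Big\|\frac{u^k(t_1^k)-u^k(t_0^k)}{h_k}\Big\|\le\tilde M,\quad\Big\|\frac{b^k(t_1^k)-b^k(t_0^k)}{h_k}\Big\|\le\tilde M,\quad \mathrm{var}(\dot u^k;[0,T])\le\tilde M,\quad \mathrm{var}(\dot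 b^k;[0,T])\le\tilde M.$$ Finally, the functions $x^k(\cdot)$ have uniformly bounded variations on $[0,T]$, and they are uniformly Lipschitzian on $[0,T]$ if $\bar x(\cdot)$ is Lipschitz continuous on $[0,T]$.
   Context: Fix $n,m\in\mathbb{N}$, $T>0$, $x_0\in\mathbb{R}^n$. Write $z=(x,u,b)$ with $x\in\mathbb{R}^n$, $u=(u_1,\ldots,u_m)\in\mathbb{R}^{nm}$ ($u_i\in\mathbb{R}^n$), $b\in\mathbb{R}^m$. Put $C(u,b):=\{x\in\mathbb{R}^n\mid\langle u_i,x\rangle\le b_i,\ i=1,\ldots,m\}$ and $F(z):=-N(x;C(u,b))$, where for a convex set $C$, $N(x;C)=\{v\mid\langle v,y-x\rangle\le0\ \forall y\in C\}$ if $x\in C$ and $N(x;C)=\emptyset$ otherwise. A feasible solution to $(P^\tau)$, $\tau\in[0,T]$, is an absolutely continuous $z(\cdot)=(x(\cdot),u(\cdot),b(\cdot))$ on $[0,T]$ with $\dot x(t)\in F(z(t))$ for a.e. $t\in[0,T]$, $x(0)=x_0\in C(u(0),b(0))$, and, for $i=1,\ldots,m$, $\|u_i(t)\|=1$ for $t\in[\tau,T-\tau]$ and $\frac12\le\|u_i(t)\|\le\frac32$ for $t\in[0,\tau)\cup(T-\tau,T]$. $j_\tau(k)$ is the smallest $j$ with $t_j^k\ge\tau$, and $j^\tau(k)$ is the largest $j$ with $t_j^k\le T-\tau$. For a piecewise linear function, its derivative is regarded as the corresponding piecewise constant function, and $\mathrm{var}(\cdot;[0,T])$ is its total variation (sum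 of norms of jumps at the interior mesh points). Derivatives at mesh points are assumed to exist where they appear (one-sided at the endpoint $0$). *)

(* Defs.v *)
From HB Require Import structures.
From mathcomp Require Import all_boot all_order all_algebra.
From mathcomp Require Import all_classical all_reals all_analysis.

Set Implicit Arguments.
Unset Strict Implicit.
Unset Printing Implicit Defensive.

Import Order.TTheory GRing.Theory Num.Theory.
Import numFieldNormedType.Exports.

Local Open Scope classical_set_scope.
Local Open Scope ring_scope.

(* A control u = (u_1, ..., u_m) in R^{nm} is the m x n matrix whose i-th row
   is u_i; the Euclidean norm of R^{nm} is then the Frobenius norm.  The norm
   `|_| that MathComp-Analysis puts on matrices is the sup norm, so Euclidean
   norms are written with enorm; both induce the same topology. *)
Section Euclidean.
Variable R : realType.

Definition enorm (p q : nat) (A : 'M[R]_(p, q)) : R :=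
  Num.sqrt (\sum_i \sum_j A i j ^+ 2).

Definition dotp (n : nat) (v w : 'rV[R]_n) : R := \sum_j v 0 j * w 0 j.

End Euclidean.

Section SweepingMap.
Variables (R : realType) (n m : nat).
Implicit Types (x : 'rV[R]_n) (u : 'M[R]_(m, n)) (b : 'rV[R]_m).

Definition polyhedron u b : set 'rV[R]_n :=
  [set x | forall i, dotp (row i u) x <= b 0 i].

Definition normal_cone (C : set 'rV[R]_n) x : set 'rV[R]_n :=
  [set v | C x /\ forall y, C y -> dotp v (y - x) <= 0].

Definition sweepF x u b : set 'rV[R]_n :=
  [set - v | v in normal_cone (polyhedron u b) x].

End SweepingMap.

(* Functions on [0, T] are represented by functions on R of which only the
   restriction to [0, T] matters: 'D_1 f t depends only on this restriction
   for 0 < t < T, and the two endpoints are Lebesgue-negligible. *)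
Section FunctionsOnInterval.
Variables (R : realType) (T : R) (p q : nat).
Implicit Type f : R -> 'M[R]_(p, q).

Definition abs_cont f : Prop :=
  forall e : R, 0 < e -> exists2 d : R, 0 < d &
    forall s : seq (R * R),
      all (fun I => [&& 0 <= I.1, I.1 <= I.2 & I.2 <= T]) s ->
      pairwise (fun I J => (I.2 <= J.1) || (J.2 <= I.1)) s ->
      \sum_(I <- s) (I.2 - I.1) < d ->
      \sum_(I <- s) enorm (f I.2 - f I.1) < e.

Definition W12 f : Prop :=
  [/\ abs_cont f,
      {ae (@lebesgue_measure R), forall t, t \in `[0, T] -> derivable f t 1},
      forall i j, measurable_fun `[0, T] (fun t => 'D_1 f t i j) &
      (\int[@lebesgue_measure R]_(t in `[0%R, T])
         (enorm ('D_1 f t) ^+ 2)%:E < +oo)%E].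

(* vector-valued analogues of variation and total_variation *)
Definition evariation f (s : seq R) : R :=
  let F := f \o nth T (0 :: s) in \sum_(0 <= i < size s) enorm (F i.+1 - F i).

Definition etotal_variation f : \bar R :=
  ereal_sup [set (evariation f s)%:E | s in itv_partition 0 T].

Definition elipschitz (L : R) f : Prop :=
  forall s t, s \in `[0, T] -> t \in `[0, T] ->
    enorm (f s - f t) <= L * `|s - t|.

(* derivative at a point of [0, T[, one-sided at 0 *)
Definition mesh_derivable f (t : R) : Prop :=
  if t == 0 then cvg (h^-1 *: (f h - f 0) @[h --> 0^'+]) else derivable f t 1.

Definition mesh_derive f (t : R) : 'M[R]_(p, q) :=
  if t == 0 then lim (h^-1 *: (f h - f 0) @[h --> 0^'+]) else 'D_1 f t.

End FunctionsOnInterval.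

Section Mesh.
Variables (R : realType) (T : R) (k : nat).

Definition step : R := T / k%:R.

Definition mesh (j : nat) : R := j%:R * step.

Definition jlow (tau : R) : nat :=
  find (fun j => tau <= mesh j) (iota 0 k.+1).

Definition jhigh (tau : R) : nat :=
  (\max_(j < k.+1 | (mesh j <= T - tau)%R) j)%N.

Variables p q : nat.
Implicit Type f : R -> 'M[R]_(p, q).

Definition diffq f (j : nat) : 'M[R]_(p, q) :=
  step^-1 *: (f (mesh j.+1) - f (mesh j)).

Definition diffq2 f (j : nat) : 'M[R]_(p, q) :=
  step^-1 *: (f (mesh j.+2) - 2 *: f (mesh j.+1) + f (mesh j)).

Definition pw_linear f : Prop :=
  forall j t, (j < k)%N -> mesh j <= t <= mesh j.+1 ->
    f t = f (mesh j) + (t - mesh j) *: diffq f j.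

(* total variation of the derivative of a piecewise linear f: this derivative
   is the step function equal to diffq f j on the j-th mesh interval *)
Definition var_deriv f : R :=
  \sum_(0 <= j < k.-1) enorm (diffq f j.+1 - diffq f j).

End Mesh.

Section Feasible.
Variables (R : realType) (n m : nat) (T : R) (x0 : 'rV[R]_n).

Definition feasible (tau : R) (x : R -> 'rV[R]_n) (u : R -> 'M[R]_(m, n))
    (b : R -> 'rV[R]_m) : Prop :=
  [/\ [/\ abs_cont T x, abs_cont T u & abs_cont T b],
      {ae (@lebesgue_measure R), forall t, t \in `[0, T] ->
         derivable x t 1 /\ sweepF (x t) (u t) (b t) ('D_1 x t)},
      x 0 = x0 /\ polyhedron (u 0) (b 0) x0,
      (forall i t, t \in `[tau, T - tau] -> enorm (row i (u t)) = 1) &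
      (forall i t, (t \in `[0, tau[) || (t \in `]T - tau, T]) ->
         1 / 2 <= enorm (row i (u t)) <= 3 / 2)].

End Feasible.

(* Main.v *)
(** Take u^k to be the piecewise linear interpolant of u, and let x^k have the
    slope v_j, the derivative of x at t_j, on the j-th mesh interval.  At the
    mesh points x^k - x is h_k times a sum of terms v_j - (difference quotient
    of x), hence at most h_k M.  Put b^k = b + <u, x^k - x> at the mesh points:
    the polyhedron C(u^k, b^k) is then C(u, b) translated by x^k - x, the
    normal cone at x^k is the one at x, and v_j lies in F(z^k(t_j)).  The
    increments of the slopes of <u, x^k - x> are summable with a bound
    involving only M and the variation of u.

    For the convergence of the derivatives, the difference quotients s_k of a
    scalar W^{1,2} function f tend to f' almost everywhere; they satisfy
    |s_k|_2 <= |f'|_2, so Fatou's lemma applied to (s_k + f')^2 and the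
    parallelogram identity give s_k -> f' in L^2.  The bound |s_k|_2 <= |f'|_2
    follows from |f t - f s| <= G t - G s for absolutely continuous f and
    nondecreasing G with |f'| <= G' almost everywhere. *)

Require Import Defs.
From HB Require Import structures.
From mathcomp Require Import all_boot all_order all_algebra.
From mathcomp Require Import all_classical all_reals all_analysis.
From mathcomp Require Import measurable_realfun ring lra.

Set Implicit Arguments.
Unset Strict Implicit.
Unset Printing Implicit Defensive.

Import Order.TTheory GRing.Theory Num.Theory.
Import numFieldNormedType.Exports.

Local Open Scope classical_set_scope.
Local Open Scope ring_scope.

(** * The Frobenius norm *)

Section EuclideanNorm.
Variable R : realType.

(** With [A], [B], [C] the three sums, the squares of [B * a i - C * b i] add up to
    [B * (A * B - C ^+ 2)]. A positive [B] can be cancelled; if [B = 0], every [b i] vanishes and so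
    does [C]. *)
Lemma cauchy_schwarz_sum (I : Type) (r : seq I) (a b : I -> R) :
  (\sum_(i <- r) a i * b i) ^+ 2 <=
  (\sum_(i <- r) a i ^+ 2) * (\sum_(i <- r) b i ^+ 2).
Proof.
set A := \sum_(i <- r) a i ^+ 2; set B := \sum_(i <- r) b i ^+ 2.
set C := \sum_(i <- r) a i * b i.
have B0 : 0 <= B by apply: sumr_ge0 => i _; exact: sqr_ge0.
have : 0 <= \sum_(i <- r) (B * a i - C * b i) ^+ 2.
  by apply: sumr_ge0 => i _; exact: sqr_ge0.
have -> : \sum_(i <- r) (B * a i - C * b i) ^+ 2 = B * (A * B - C ^+ 2).
  rewrite (eq_bigr (fun i => B ^+ 2 * a i ^+ 2 +
     (- (2 * B * C) * (a i * b i) + C ^+ 2 * b i ^+ 2))); last first.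
    by move=> i _; ring.
  rewrite !big_split/= -!mulr_sumr -/A -/B -/C; ring.
have [B1|] := ltP 0 B; first by rewrite pmulr_rge0// subr_ge0.
move=> Ble0 _; have {}B0 : B = 0 by apply/eqP; rewrite eq_le Ble0 B0.
suff -> : C = 0 by rewrite expr0n/= B0 mulr0.
rewrite /C; move: B0; rewrite /B; elim: (r) => [|i s IH]; first by rewrite !big_nil.
rewrite !big_cons => /eqP; rewrite paddr_eq0 ?sqr_ge0//; last first.
  by apply: sumr_ge0 => j _; exact: sqr_ge0.
by rewrite sqrf_eq0 => /andP[/eqP -> /eqP/IH ->]; rewrite mulr0 addr0.
Qed.

Lemma enorm_ge0 (p q : nat) (A : 'M[R]_(p, q)) : 0 <= enorm A.
Proof. exact: sqrtr_ge0. Qed.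

Lemma sqr_enorm (p q : nat) (A : 'M[R]_(p, q)) :
  enorm A ^+ 2 = \sum_i \sum_j A i j ^+ 2.
Proof.
rewrite sqr_sqrtr//; apply: sumr_ge0 => i _; apply: sumr_ge0 => j _.
exact: sqr_ge0.
Qed.

Lemma enormZ (p q : nat) (a : R) (A : 'M[R]_(p, q)) :
  enorm (a *: A) = `|a| * enorm A.
Proof.
rewrite /enorm -(sqrtr_sqr a) -sqrtrM ?sqr_ge0//; congr Num.sqrt.
rewrite mulr_sumr; apply: eq_bigr => i _; rewrite mulr_sumr; apply: eq_bigr => j _.
by rewrite mxE exprMn.
Qed.

Lemma enorm0 (p q : nat) : enorm (0 : 'M[R]_(p, q)) = 0.
Proof. by rewrite -(scale0r 0) enormZ normr0 mul0r. Qed.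

Lemma enormN (p q : nat) (A : 'M[R]_(p, q)) : enorm (- A) = enorm A.
Proof. by rewrite -scaleN1r enormZ normrN1 mul1r. Qed.

Lemma enormB (p q : nat) (A B : 'M[R]_(p, q)) : enorm (A - B) = enorm (B - A).
Proof. by rewrite -opprB enormN. Qed.

Lemma ler_enormD (p q : nat) (A B : 'M[R]_(p, q)) :
  enorm (A + B) <= enorm A + enorm B.
Proof.
rewrite -(@ler_pXn2r _ 2)// ?nnegrE ?addr_ge0 ?enorm_ge0//.
rewrite sqrrD !sqr_enorm !pair_bigA/=.
rewrite (eq_bigr (fun ij => A ij.1 ij.2 ^+ 2 +
    (2 * (A ij.1 ij.2 * B ij.1 ij.2) + B ij.1 ij.2 ^+ 2))); last first.
  by move=> ij _; rewrite mxE; ring.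
rewrite !big_split/= -mulr_sumr -addrA lerD2l lerD2r -[leRHS]mulr_natl ler_pM2l//.
apply: le_trans (ler_norm _) _.
rewrite -(@ler_pXn2r _ 2)// ?nnegrE ?mulr_ge0 ?enorm_ge0//.
rewrite real_normK ?num_real// exprMn !sqr_enorm !pair_bigA.
exact: cauchy_schwarz_sum.
Qed.

Lemma ler_enormB (p q : nat) (A B : 'M[R]_(p, q)) :
  enorm (A - B) <= enorm A + enorm B.
Proof. by rewrite -(enormN B) ler_enormD. Qed.

Lemma ler_enorm_sum (p q : nat) (I : Type) (r : seq I) (P : pred I)
    (F : I -> 'M[R]_(p, q)) :
  enorm (\sum_(i <- r | P i) F i) <= \sum_(i <- r | P i) enorm (F i).
Proof.
elim/big_ind2 : _ => [|A a B b Aa Bb|//]; first by rewrite enorm0.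
exact: le_trans (ler_enormD _ _) (lerD Aa Bb).
Qed.

Lemma ler_entry_enorm (p q : nat) (A : 'M[R]_(p, q)) i j : `|A i j| <= enorm A.
Proof.
rewrite -(@ler_pXn2r _ 2)// ?nnegrE ?enorm_ge0//.
rewrite real_normK ?num_real// sqr_enorm (bigD1 i)//= (bigD1 j)//= -addrA lerDl.
by apply: addr_ge0; repeat (apply: sumr_ge0 => ? _ || exact: sqr_ge0).
Qed.

Lemma ler_norm_enorm (p q : nat) (A : 'M[R]_(p, q)) : `|A| <= enorm A.
Proof.
by rewrite [leLHS]mx_normrE; apply: bigmax_le => [|[i j] _];
  [exact: enorm_ge0|exact: ler_entry_enorm].
Qed.

(** Triangle inequality for the expansion of [A] in elementary matrices, each of norm 1. *)
Lemma ler_enorm_entries (p q : nat) (A : 'M[R]_(p, q)) :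
  enorm A <= \sum_i \sum_j `|A i j|.
Proof.
rewrite {1}(matrix_sum_delta A); apply: le_trans (ler_enorm_sum _ _ _) _.
apply: ler_sum => i _; apply: le_trans (ler_enorm_sum _ _ _) _.
apply: ler_sum => j _; rewrite enormZ ler_piMr// /enorm.
rewrite (_ : \sum_k _ = 1) ?sqrtr1//.
rewrite (bigD1 i)//= [X in _ + X]big1 ?addr0; last first.
  by move=> k /negbTE ki; apply: big1 => l _; rewrite mxE ki expr0n.
rewrite (bigD1 j)//= big1 ?addr0 ?mxE ?eqxx ?expr1n//.
by move=> k /negbTE kj; rewrite mxE kj andbF expr0n.
Qed.

(** The entries of [A *m B^T] are inner products of rows of [A] with rows of [B]; Cauchy-Schwarz on
    each entry leaves a double sum that factors. *)
Lemma ler_enorm_mulmx_tr (p q n : nat) (A : 'M[R]_(p, n)) (B : 'M[R]_(q, n)) :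
  enorm (A *m B^T) <= enorm A * enorm B.
Proof.
rewrite -(@ler_pXn2r _ 2)// ?nnegrE ?mulr_ge0 ?enorm_ge0//.
rewrite exprMn !sqr_enorm mulr_suml; apply: ler_sum => i _.
rewrite mulr_sumr; apply: ler_sum => j _; rewrite mxE.
under eq_bigr do rewrite mxE.
exact: cauchy_schwarz_sum.
Qed.

Lemma dotpE (m n : nat) (B : 'M[R]_(m, n)) (x : 'rV[R]_n) i :
  dotp (row i B) x = (x *m B^T) 0 i.
Proof. by rewrite mxE; apply: eq_bigr => j _; rewrite !mxE mulrC. Qed.

End EuclideanNorm.

(** * Piecewise linear functions on a uniform mesh *)

Section PiecewiseLinear.
Variables (R : realType) (p q : nat).
Implicit Types (T : R) (d : nat -> 'M[R]_(p, q)).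

(** For [h = step T k], [s = t - mesh T k j] and [t >= 0], this is the length of the part of
    [[0, t]] lying in the [j]-th mesh interval. Summed against slopes, it integrates a step function
    without locating [t] in the mesh. *)
Definition clamp (h s : R) : R := Num.max 0 (Num.min s h).

Lemma clamp_ge (h s : R) : 0 <= h -> h <= s -> clamp h s = h.
Proof. by move=> h0 hs; rewrite /clamp min_r// max_r. Qed.

Lemma clamp_le0 (h s : R) : s <= 0 -> clamp h s = 0.
Proof. by move=> s0; rewrite /clamp max_l// ge_min s0. Qed.

Lemma clamp_id (h s : R) : 0 <= s <= h -> clamp h s = s.
Proof. by case/andP=> s0 sh; rewrite /clamp min_l// max_r. Qed.

Lemma le_clamp (h s t : R) : s <= t -> clamp h s <= clamp h t.
Proof. by move=> st; rewrite /clamp; apply: le_max2 => //; exact: le_min2. Qed.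

(* Piecewise linear function on the uniform mesh with value a at 0 and slope
   d j on the j-th mesh interval. *)
Definition plin T (k : nat) (a : 'M[R]_(p, q)) d (t : R) : 'M[R]_(p, q) :=
  a + \sum_(0 <= j < k) clamp (step T k) (t - mesh T k j) *: d j.

Lemma meshS T k j : mesh T k j.+1 = mesh T k j + step T k.
Proof. by rewrite /mesh -addn1 natrD mulrDl mul1r. Qed.

Lemma mesh0 T k : mesh T k 0 = 0.
Proof. by rewrite /mesh mul0r. Qed.

Lemma mesh_last T k : (0 < k)%N -> mesh T k k = T.
Proof. by move=> k0; rewrite /mesh /step mulrC divfK// pnatr_eq0 -lt0n. Qed.

Lemma step_gt0 T k : 0 < T -> (0 < k)%N -> 0 < step T k.
Proof. by move=> T0 k0; rewrite divr_gt0// ltr0n. Qed.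

Lemma step_ge0 T k : 0 < T -> 0 <= step T k.
Proof. by move=> T0; rewrite divr_ge0// ltW. Qed.

Lemma step_neq0 T k : 0 < T -> (0 < k)%N -> step T k != 0.
Proof. by move=> T0 k0; rewrite gt_eqF// step_gt0. Qed.

Lemma le_mesh T k i j : 0 < T -> (i <= j)%N -> mesh T k i <= mesh T k j.
Proof. by move=> T0 ij; rewrite ler_wpM2r ?step_ge0// ler_nat. Qed.

Lemma lt_mesh T k i j : 0 < T -> (0 < k)%N -> (i < j)%N ->
  mesh T k i < mesh T k j.
Proof. by move=> T0 k0 ij; rewrite ltr_pM2r ?step_gt0// ltr_nat. Qed.

Lemma mesh_ge0 T k j : 0 < T -> 0 <= mesh T k j.
Proof. by move=> T0; rewrite mulr_ge0// step_ge0. Qed.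

Lemma mesh_le T k j : 0 < T -> (0 < k)%N -> (j <= k)%N -> mesh T k j <= T.
Proof. by move=> T0 k0 jk; rewrite -[leRHS](mesh_last T k0) le_mesh. Qed.

Lemma mesh_in T k j : 0 < T -> (0 < k)%N -> (j <= k)%N ->
  mesh T k j \in `[0, T].
Proof. by move=> *; rewrite in_itv/= mesh_ge0// mesh_le. Qed.

Lemma mesh_cover T k t : 0 < T -> (0 < k)%N -> 0 <= t <= T ->
  exists2 j, (j < k)%N & mesh T k j <= t <= mesh T k j.+1.
Proof.
move=> T0 k0 /andP[t0 tT].
suff /(_ k (leqnn k)) : forall l, (l <= k)%N -> t <= mesh T k l ->
    exists2 j, (j < k)%N & mesh T k j <= t <= mesh T k j.+1.
  by apply; rewrite mesh_last.
elim=> [_|l IH lk tl]; last first.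
  by have [/IH|/ltW lt] := leP t (mesh T k l);
    [by apply; exact: ltnW|exists l => //; rewrite lt].
rewrite mesh0 => tle0; exists 0%N => //; rewrite mesh0 t0/=.
by rewrite (le_trans tle0)// mesh_ge0.
Qed.

(** Intervals before the [j]-th contribute a full step, later ones nothing. *)
Lemma plin_local T k a d j t : 0 < T -> (j < k)%N ->
  mesh T k j <= t <= mesh T k j.+1 ->
  plin T k a d t = a + \sum_(0 <= i < j) step T k *: d i + (t - mesh T k j) *: d j.
Proof.
move=> T0 jk /andP[jt tj]; rewrite /plin -addrA; congr (_ + _).
rewrite (@big_cat_nat _ _ _ j)//=; last exact: ltnW.
rewrite (@big_ltn _ _ _ j)//; congr (_ + _).
  apply: eq_big_nat => i /andP[_ ij]; rewrite clamp_ge ?step_ge0//.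
  by rewrite lerBrDl -meshS (le_trans _ jt)// le_mesh.
rewrite clamp_id; last by rewrite subr_ge0 jt lerBlDl -meshS.
rewrite big_nat big1 ?addr0// => i /andP[ji _]; rewrite clamp_le0 ?scale0r//.
by rewrite subr_le0 (le_trans tj)// le_mesh.
Qed.

Lemma plin_mesh T k a d j : 0 < T -> (0 < k)%N -> (j <= k)%N ->
  plin T k a d (mesh T k j) = a + step T k *: \sum_(0 <= i < j) d i.
Proof.
move=> T0 k0; rewrite leq_eqVlt => /orP[/eqP ->|jk]; last first.
  rewrite (@plin_local _ _ _ _ j)// ?lexx ?le_mesh// subrr scale0r addr0.
  by rewrite scaler_sumr.
case: k k0 => // k _.
rewrite (@plin_local _ _ _ _ k)// ?lexx ?le_mesh//.
by rewrite meshS (addrAC (mesh _ _ _)) subrr add0r -addrA -big_nat_recr//= scaler_sumr.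
Qed.

Lemma diffq_plin T k a d j : 0 < T -> (j < k)%N ->
  diffq T k (plin T k a d) j = d j.
Proof.
move=> T0 jk; have k0 := leq_ltn_trans (leq0n j) jk.
rewrite /diffq !plin_mesh//; last exact: ltnW.
rewrite opprD addrACA subrr add0r -scalerBr big_nat_recr//= (addrC _ (d j)) addrK.
by rewrite scalerA mulVf ?scale1r// step_neq0.
Qed.

Lemma pw_linear_plin T k a d : 0 < T -> pw_linear T k (plin T k a d).
Proof.
move=> T0 j t jk jt; rewrite diffq_plin// (@plin_local _ _ _ _ j t)//.
by rewrite (@plin_local _ _ _ _ j (mesh T k j)) ?lexx ?le_mesh// subrr scale0r addr0.
Qed.

Lemma plin0 T k a d : 0 < T -> (0 < k)%N -> plin T k a d 0 = a.
Proof.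
move=> T0 k0; have := plin_mesh a d T0 k0 (leq0n k).
by rewrite mesh0 big_geq// scaler0 addr0.
Qed.

(** The mesh intervals cut [[0, t]] into pieces of total length [t]; this turns a bound on slopes
    into a Lipschitz constant. *)
Lemma sum_clamp T k t : 0 < T -> (0 < k)%N -> 0 <= t <= T ->
  \sum_(0 <= j < k) clamp (step T k) (t - mesh T k j) = t.
Proof.
move=> T0 k0 /(mesh_cover T0 k0)[j jk /andP[jt tj]].
rewrite (@big_cat_nat _ _ _ j)//=; last exact: ltnW.
rewrite (@big_ltn _ _ _ j)//.
rewrite (@eq_big_nat _ _ _ 0%N j _ (fun _ => step T k)); last first.
  move=> i /andP[_ ij]; rewrite clamp_ge ?step_ge0//.
  by rewrite lerBrDl -meshS (le_trans _ jt)// le_mesh.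
rewrite clamp_id; last by rewrite subr_ge0 jt lerBlDl -meshS.
rewrite [X in _ + (_ + X)]big_nat [X in _ + (_ + X)]big1 ?addr0; last first.
  move=> i /andP[ji _]; rewrite clamp_le0//.
  by rewrite subr_le0 (le_trans tj)// le_mesh.
by rewrite sumr_const_nat subn0 -mulr_natl addrC subrK.
Qed.

(** Clamps are nondecreasing in time, so the bound is itself the increment of a nondecreasing
    function, as both the Lipschitz and the variation estimate require. *)
Lemma plin_increment T k a d s t : s <= t ->
  enorm (plin T k a d t - plin T k a d s) <=
  \sum_(0 <= j < k) (clamp (step T k) (t - mesh T k j)
                     - clamp (step T k) (s - mesh T k j)) * enorm (d j).
Proof.
move=> st; rewrite /plin opprD addrACA subrr add0r -sumrB.
apply: le_trans (ler_enorm_sum _ _ _) _; apply: ler_sum => j _.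
by rewrite -scalerBl enormZ ger0_norm// subr_ge0 le_clamp// lerB.
Qed.

Lemma elipschitz_plin T k a d (L : R) : 0 < T -> (0 < k)%N ->
  (forall j, (j < k)%N -> enorm (d j) <= L) -> elipschitz T L (plin T k a d).
Proof.
move=> T0 k0 dL s t; wlog st : s t / s <= t => [H sT tT|].
  have [|/ltW] := leP s t; first by move/H; apply.
  by move=> /H; rewrite enormB distrC; apply.
rewrite !in_itv/= => sT tT; rewrite enormB distrC ger0_norm ?subr_ge0//.
apply: le_trans (plin_increment _ _ _ _ st) _.
rewrite -[in leRHS](sum_clamp T0 k0 sT) -[in leRHS](sum_clamp T0 k0 tT).
rewrite -sumrB mulr_sumr !big_nat; apply: ler_sum => j /andP[_ jk].
by rewrite mulrC ler_wpM2r ?dL// subr_ge0 le_clamp// lerB.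
Qed.

(** The increments of [G] telescope along every partition. *)
Lemma etotal_variation_le T (f : R -> 'M[R]_(p, q)) (G : R -> R) :
  (forall s t, 0 <= s -> s <= t -> t <= T -> enorm (f t - f s) <= G t - G s) ->
  (etotal_variation T f <= (G T - G 0)%:E)%E.
Proof.
move=> fG; apply: ge_ereal_sup => _ [s /= ps <-]; rewrite lee_fin.
have [sp /eqP sT] := ps.
rewrite /evariation -[X in G X - _]sT.
have -> : G (last 0 s) - G 0 =
    \sum_(0 <= i < size s) (G (nth T (0 :: s) i.+1) - G (nth T (0 :: s) i)).
  by rewrite (telescope_sumr (fun i => G (nth T (0 :: s) i)))//= nth_last;
    case: (s) => //=.
rewrite !big_nat; apply: ler_sum => i /andP[_ si]; apply: fG.
- by apply: itv_partition_nth_ge ps; rewrite ltnS ltnW.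
- by apply: ltW; move/pathP : sp => /(_ T i si).
- by apply: itv_partition_nth_le ps; rewrite ltnS.
Qed.

End PiecewiseLinear.

(** * Increments of absolutely continuous functions *)

Section AbsolutelyContinuous.
Variable R : realType.
Local Notation mu := (@lebesgue_measure R).

(** Induction along an interval: points satisfying [P] come arbitrarily close to their supremum from
    the left, and the local passage at the supremum carries [P] beyond it unless [b] has been
    reached. *)
Lemma cousin_induction (P : R -> Prop) (a b : R) : a <= b -> P a ->
  (forall x, a <= x <= b -> exists2 r : R, 0 < r &
     forall y z, a <= y <= x -> x <= z <= b -> x - r < y -> z < x + r ->
       P y -> P z) ->
  P b.
Proof.
move=> ab Pa step; pose S := [set y | a <= y <= b /\ P y].
have Sa : S a by split => //; rewrite lexx.
have supS : has_sup S.
  by split; [exists a|exists b => y [/andP[]]].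
have asup : a <= sup S by exact: ub_le_sup supS.2 _ Sa.
have supb : sup S <= b by apply: ge_sup => [|y [/andP[]//]]; exists a.
have [|r r0 rP] := step (sup S); first by rewrite asup.
have [y [/andP[ay yb] Py] ry] := sup_adherent r0 supS.
have ysup : y <= sup S by apply: ub_le_sup supS.2 _ _; split => //; rewrite ay.
(* If this point differs from [b], it lies in [S] strictly above [sup S]. *)
pose z := Num.min b (sup S + r / 2).
have zb : z <= b by rewrite ge_min lexx.
have supz : sup S <= z by rewrite le_min supb lerDl divr_ge0// ltW.
have zr : z < sup S + r.
  by rewrite gt_min ltrD2l ltr_pdivrMr// ltr_pMr// ltr1n orbT.
have Pz : P z by apply: (rP y) => //; rewrite ?ay ?supz ?zb.
have [<-//|zneb] := eqVneq z b.
have : z <= sup S.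
  by apply: ub_le_sup supS.2 _ _; split => //; rewrite zb (le_trans asup).
have -> : z = sup S + r / 2.
  by move: zneb; rewrite /z; case: (leP b) => //; rewrite eqxx.
by rewrite gerDl leNgt divr_gt0.
Qed.

(** Differentiability as a first-order expansion: with the quotient multiplied out, [z = x] is
    allowed. *)
Lemma derivable_near (f : R -> R) (x e : R) : derivable f x 1 -> 0 < e ->
  exists2 r : R, 0 < r & forall z, `|z - x| < r ->
    `|f z - f x - 'D_1 f x * (z - x)| <= e * `|z - x|.
Proof.
move=> df e0.
have /cvgrPdist_le/(_ _ e0) : h^-1 *: (f (h *: 1 + x) - f x) @[h --> 0^'] --> 'D_1 f x.
  exact: df.
move=> /nbhs_ballP[r /= r0 rP]; exists r => // z zr.
have [->|zx] := eqVneq z x; first by rewrite !subrr mulr0 subr0 normr0 mulr0.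
have zx0 : z - x != 0 by rewrite subr_eq0.
have /= := rP (z - x).
rewrite /ball/= sub0r normrN => /(_ zr zx0).
rewrite /GRing.scale/= mulr1 subrK => H.
rewrite -(ler_pM2r (x := `|z - x|)) ?normr_gt0// in H.
apply: le_trans H; rewrite -normrM distrC mulrBl mulrAC mulVf// mul1r//.
Qed.

Definition ac_real (T : R) (f : R -> R) : Prop :=
  forall e : R, 0 < e -> exists2 d : R, 0 < d &
    forall s : seq (R * R),
      all (fun I => [&& 0 <= I.1, I.1 <= I.2 & I.2 <= T]) s ->
      pairwise (fun I J => (I.2 <= J.1) || (J.2 <= I.1)) s ->
      \sum_(I <- s) (I.2 - I.1) < d ->
      \sum_(I <- s) `|f I.2 - f I.1| < e.

Lemma negligible_finite (A : set R) : finite_set A -> mu.-negligible A.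
Proof.
move=> fA; exists A; split => //.
  by apply: countable_measurable; [exact: measurable_set1|exact: finite_set_countable].
by apply: countable_lebesgue_measure0; exact: finite_set_countable.
Qed.

(** Outer regularity makes the excess of [U] over a measurable null set [M] containing [N] smaller
    than [d], and [M] itself adds no measure. *)
Lemma null_set_open_cover (N : set R) (d : R) : mu.-negligible N -> 0 < d ->
  exists2 U : set R, open U & N `<=` U /\ (mu U < d%:E)%E.
Proof.
move=> [M [mM M0 NM]] d0.
have [|U [oU MU Ud]] := lebesgue_regularity_outer mM _ d0.
  by rewrite [X in (X < _)%E]M0 ltry.
exists U => //; split; first exact: subset_trans NM MU.
apply: le_lt_trans Ud; rewrite -[leRHS]add0e -[X in (X + _)%E]M0.
have mU : measurable U by exact: open_measurable.
rewrite -{1}(setDUK MU) measureU//; first exact: measurableD.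
by rewrite setDIK.
Qed.

(** * Increments controlled outside an open set of small measure *)

Section IncrementBound.
Variables (T : R) (f G : R -> R).
Hypothesis G_homo : forall s t, 0 <= s -> s <= t -> t <= T -> G s <= G t.
Variables (a eta : R) (U : set R).
Hypotheses (a0 : 0 <= a) (eta0 : 0 < eta) (oU : open U).

Let tame (y z : R) := `|f z - f y| <= G z - G y + eta * (z - y).

(* Up to y, the increments of f are controlled by G, except on finitely many
   disjoint intervals contained in U. *)
Let controlled (y : R) := exists s : seq (R * R),
  [/\ all (fun I => [&& a <= I.1, I.1 <= I.2 & I.2 <= y]) s,
      pairwise (fun I J => (I.2 <= J.1) || (J.2 <= I.1)) s,
      ((\sum_(I <- s) (I.2 - I.1))%:E <= mu (U `&` `[a, y]))%E &
      `|f y - f a| <= G y - G a + eta * (y - a)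
                      + \sum_(I <- s) `|f I.2 - f I.1| ].

(** A tame increment is absorbed by [G] and the [eta] term. Otherwise [(y, z)] joins the list of
    exceptional intervals, and [G] contributes a non-negative amount. *)
Let controlled_step (y z : R) : a <= y -> y <= z -> z <= T ->
  tame y z \/ `[y, z] `<=` U -> controlled y -> controlled z.
Proof.
move=> ay yz zT yzU [s [sa sp sU sf]].
have mU : measurable U by exact: open_measurable.
have mUy w : measurable (U `&` `[a, w]) by exact: measurableI.
have sub : `[a, y] `<=` `[a, z].
  by apply: subset_itvl; rewrite bnd_simp.
have sa' : all (fun I => [&& a <= I.1, I.1 <= I.2 & I.2 <= z]) s.
  apply: sub_all sa => I /and3P[-> -> Iy]/=; exact: le_trans yz.
have tri : `|f z - f a| <= `|f z - f y| + `|f y - f a|.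
  by rewrite (le_trans _ (ler_normD _ _))// addrA subrK.
case: yzU => [yz_tame|yzU].
  exists s; split => //.
    apply: le_trans sU _; apply: le_measure; [by rewrite inE; exact: mUy..|].
    by move=> w [Uw yw]; split => //; exact: sub.
  by apply: le_trans tri _; move: yz_tame; rewrite /tame; lra.
exists ((y, z) :: s); split => /=.
- by rewrite ay yz lexx.
- rewrite sp andbT; apply: sub_all sa => I /and3P[_ _ Iy].
  by rewrite Iy orbT.
(* The new length is measured on the half-open []y, z]], which is disjoint from [[a, y]], so that
   the two measures add. *)
- rewrite big_cons/= EFinD.
  have -> : (z - y)%:E = mu `]y, z].
    by rewrite lebesgue_measure_itv/= lte_fin; case: ltP => // zy;
      rewrite (le_anti (_ : z <= y <= z)) ?zy// subrr.
  apply: le_trans (leeD (lexx _) sU) _.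
  rewrite addeC -measureU//; [|exact: mUy|].
    2: apply/seteqP; split => w //= -[[_ wy] wz].
    2: by move: wy wz; rewrite !in_itv/= => /andP[_ wy] /andP[yw _]; lra.
  apply: le_measure; rewrite ?inE; [by apply: measurableU => //; exact: mUy|exact: mUy|].
  move=> w [[Uw wy]|]; first by split => //; exact: sub.
  rewrite /= in_itv/= => /andP[yw wz]; split.
    by apply: yzU; rewrite /= in_itv/= (ltW yw).
  by rewrite /= in_itv/= wz (le_trans ay (ltW yw)).
- rewrite big_cons/=; apply: le_trans tri _.
  have := G_homo (le_trans a0 ay) yz zT.
  have : 0 <= eta * (z - y) by rewrite mulr_ge0 ?subr_ge0// ltW.
  lra.
Qed.

(** Induction along [[a, b]]: a point of [U] has a ball inside [U], which gives exceptional
    intervals; near any other point increments are tame. *)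
Let controlled_increment (b : R) : a <= b -> b <= T ->
  (forall x, 0 <= x <= T -> ~ U x -> exists2 r : R, 0 < r &
     forall y z, y <= x <= z -> x - r < y -> z < x + r -> tame y z) ->
  controlled b.
Proof.
move=> ab bT H; apply: (cousin_induction ab).
  exists [::]; split => //; first by rewrite big_nil measure_ge0.
  by rewrite !subrr normr0 mulr0 big_nil !addr0.
move=> x /andP[ax xb]; have [Ux|nUx] := pselect (U x).
  have /nbhs_ballP[r /= r0 rU] : nbhs x U by exact: open_nbhs_nbhs.
  exists r => // y z /andP[ay yx] /andP[xz zb] xry zxr.
  apply: controlled_step => //; [exact: le_trans xz|exact: le_trans bT|right].
  move=> w /=; rewrite in_itv/= => /andP[yw wz]; apply: rU.
  by rewrite /ball/= ltr_distlC; apply/andP; split; lra.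
have [|r r0 rH] := H x _ nUx.
  by rewrite (le_trans a0 ax) (le_trans xb bT).
exists r => // y z /andP[ay yx] /andP[xz zb] xry zxr.
apply: controlled_step => //; [exact: le_trans xz|exact: le_trans bT|left].
by apply: rH => //; rewrite yx.
Qed.

(** The exceptional intervals have total length at most the measure of [U], hence below [d], so
    absolute continuity bounds their contribution by [e]. *)
Lemma increment_le_open_cover (b d e : R) : a <= b -> b <= T ->
  (forall x, 0 <= x <= T -> ~ U x -> exists2 r : R, 0 < r &
     forall y z, y <= x <= z -> x - r < y -> z < x + r ->
       `|f z - f y| <= G z - G y + eta * (z - y)) ->
  (mu U < d%:E)%E ->
  (forall s : seq (R * R),
      all (fun I => [&& 0 <= I.1, I.1 <= I.2 & I.2 <= T]) s ->
      pairwise (fun I J => (I.2 <= J.1) || (J.2 <= I.1)) s ->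
      \sum_(I <- s) (I.2 - I.1) < d ->
      \sum_(I <- s) `|f I.2 - f I.1| < e) ->
  `|f b - f a| <= G b - G a + eta * (b - a) + e.
Proof.
move=> ab bT /(controlled_increment ab bT)[s [sa sp sU sf]] Ud ac.
apply: le_trans sf _; rewrite lerD2l; apply/ltW/ac => //.
  apply: sub_all sa => I /and3P[aI -> Ib]/=.
  by rewrite (le_trans a0 aI) (le_trans Ib bT).
rewrite -lte_fin; apply: le_lt_trans Ud; apply: le_trans sU _.
apply: le_measure; rewrite ?inE.
- by apply: measurableI => //; exact: open_measurable.
- exact: open_measurable.
- by move=> w [].
Qed.

End IncrementBound.

(** The bad points form a null set, covered by an open set too small to matter for the absolutely
    continuous [f]. At every other point the first-order expansions of [f] and [G] make increments
    tame. *)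
Lemma ac_increment_le (T : R) (f G : R -> R) : ac_real T f ->
  (forall s t, 0 <= s -> s <= t -> t <= T -> G s <= G t) ->
  {ae mu, forall t, 0 < t < T ->
     [/\ derivable f t 1, derivable G t 1 & `|'D_1 f t| <= 'D_1 G t]} ->
  forall a b, 0 <= a -> a <= b -> b <= T -> `|f b - f a| <= G b - G a.
Proof.
move=> acf Ghomo dfG a b a0 ab bT; apply/ler_addgt0Pr => e e0.
(* Half of [e] pays for the [eta] term, half for the exceptional intervals; the summand 1 keeps the
   denominator positive when [a = b]. *)
pose eta := e / 2 / (1 + (b - a)).
have ba1 : 0 < 1 + (b - a) by rewrite ltr_pwDl// subr_ge0.
have eta0 : 0 < eta by rewrite !divr_gt0.
have etab : eta * (b - a) <= e / 2.
  rewrite /eta mulrAC ler_pdivrMr// ler_pM2l ?divr_gt0//; lra.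
have [d d0 acd] := acf _ (divr_gt0 e0 (ltr0Sn R 1)).
(* The endpoints join the null set because differentiability is given only on the open interval. *)
pose N := ~` [set t | 0 < t < T ->
     [/\ derivable f t 1, derivable G t 1 & `|'D_1 f t| <= 'D_1 G t]] `|` [set 0; T].
have N0 : mu.-negligible N.
  apply: negligibleU; first exact: dfG.
  exact: negligible_finite.
have [U oU [NU Ud]] := null_set_open_cover N0 d0.
suff H x : 0 <= x <= T -> ~ U x -> exists2 r : R, 0 < r &
     forall y z, y <= x <= z -> x - r < y -> z < x + r ->
       `|f z - f y| <= G z - G y + eta * (z - y).
  have := increment_le_open_cover Ghomo a0 eta0 oU ab bT H Ud acd; lra.
move=> /andP[x0 xT] nUx.
have xT' : 0 < x < T.
  rewrite !lt_neqAle x0 xT !andbT; apply/andP; split.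
    by apply/eqP => x0'; apply/nUx/NU; right; left; rewrite -x0'.
  by apply/eqP => x0'; apply/nUx/NU; right; right; rewrite -x0'.
have [df dG fG] : [/\ derivable f x 1, derivable G x 1 & `|'D_1 f x| <= 'D_1 G x].
  apply: contrapT => H; apply/nUx/NU; left => /=; move/(_ xT') => //.
(* The errors at [y] and [z] add up to [eta / 2 * (z - y)], once for [f] and once for [G]. *)
have eta20 : 0 < eta / 2 by rewrite divr_gt0.
have [r1 r10 fr1] := derivable_near df eta20.
have [r2 r20 Gr2] := derivable_near dG eta20.
exists (Num.min r1 r2); first by rewrite lt_min r10.
move=> y z /andP[yx xz] xry zxr.
have {xry} [yr1 yr2] : x - r1 < y /\ x - r2 < y.
  by split; apply: le_lt_trans xry; rewrite lerB// ge_min lexx ?orbT.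
have {zxr} [zr1 zr2] : z < x + r1 /\ z < x + r2.
  by split; apply: lt_le_trans zxr _; rewrite lerD2l// ge_min lexx ?orbT.
have Ey : `|y - x| = x - y by rewrite distrC ger0_norm// subr_ge0.
have Ez : `|z - x| = z - x by rewrite ger0_norm// subr_ge0.
have := fr1 y; have := fr1 z; have := Gr2 y; have := Gr2 z.
rewrite Ey Ez => /(_ ltac:(lra)) Gz /(_ ltac:(lra)) Gy.
move=> /(_ ltac:(lra)) fz /(_ ltac:(lra)) fy.
move: Gz Gy fz fy; rewrite !ler_distl => /andP[Gz1 _] /andP[_ Gy2] /andP[fz1 fz2] /andP[fy1 fy2].
have [H1 H2] : 'D_1 f x <= 'D_1 G x /\ - 'D_1 G x <= 'D_1 f x.
  by move: fG; rewrite ler_norml => /andP[].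
have zy : 0 <= z - y by lra.
(* These two products are the only nonlinear facts that the final linear arithmetic needs. *)
have := mulr_ge0 (_ : 0 <= 'D_1 G x - 'D_1 f x) zy.
have := mulr_ge0 (_ : 0 <= 'D_1 G x + 'D_1 f x) zy.
by move=> /(_ ltac:(lra)) P1 /(_ ltac:(lra)) P2; apply/andP; split; lra.
Qed.

End AbsolutelyContinuous.

(** * Square integrable derivatives and difference quotients *)

Section ScalarSobolev.
Variable R : realType.
Local Notation mu := (@lebesgue_measure R).

Lemma derive_affine_comb (E : R -> R) (a b x : R) : derivable E x 1 ->
  let G := fun y => a * E y + b * y in
  derivable G x 1 /\ 'D_1 G x = a * 'D_1 E x + b.
Proof.
move=> dE G; have -> : G = (a \*: E + b \*: id)%R by [].
have dI : derivable (id : R -> R) x 1 by exact: derivable_id.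
have dE1 := @derivableZ _ _ _ E a x 1 dE; have dI1 := @derivableZ _ _ _ id b x 1 dI.
split; first exact: (derivableD dE1 dI1).
rewrite (deriveD dE1 dI1) (deriveZ _ dE) (deriveZ _ dI).
by rewrite derive_id /GRing.scale/= mulr1.
Qed.

(** * Cauchy-Schwarz for increments with a square integrable derivative *)

Section SquareIntegrableDerivative.
Variables (T : R) (f g : R -> R).
Hypotheses (T0 : 0 < T) (acf : ac_real T f).
Hypothesis dfg : {ae mu, forall t, t \in `[0, T] ->
  derivable f t 1 /\ 'D_1 f t = g t}.
Hypothesis mg : measurable_fun `[0, T] g.
Hypothesis g2 : (\int[mu]_(t in `[0%R, T]) (g t ^+ 2)%:E < +oo)%E.

(** The primitive of the square of [g]. The extension by zero outside [[0, T]] makes the integrand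
    integrable on the whole line, the form in which the fundamental theorem of calculus is
    applied. *)
Definition energy (x : R) : R :=
  (\int[mu]_(t in `[0%R, x]) ((fun t => g t ^+ 2) \_ `[0%R, T]) t)%R.

Let mg2 : measurable_fun `[0, T] (fun t => g t ^+ 2).
Proof. exact: measurable_funX. Qed.

Let intg2 : mu.-integrable `[0, T] (EFin \o (fun t => g t ^+ 2)).
Proof.
apply/integrableP; split; first exact/measurable_EFinP.
under eq_integral => t _ do rewrite /= ger0_norm ?sqr_ge0//.
exact: g2.
Qed.

Let intr : mu.-integrable setT (EFin \o ((fun t => g t ^+ 2) \_ `[0, T])).
Proof. by rewrite -restrict_EFin; apply/(integrable_mkcond _ _).1. Qed.

Let intrS (D : set R) : measurable D ->
  mu.-integrable D (EFin \o ((fun t => g t ^+ 2) \_ `[0, T])).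
Proof. by move=> mD; exact: integrableS intr. Qed.

Let patch_ge0 t : 0 <= ((fun t => g t ^+ 2) \_ `[0, T]) t.
Proof. by rewrite patchE; case: ifP => // _; exact: sqr_ge0. Qed.

Lemma energy_homo (s t : R) : s <= t -> energy s <= energy t.
Proof.
move=> st; rewrite -subr_ge0; have [s0|s0] := leP 0 s.
  rewrite /energy Rintegral_itvB//.
  - exact: Rintegral_ge0.
  - exact: intrS.
(* For [s < 0] the domain of integration is empty and [energy s] is 0. *)
rewrite {2}/energy set_itv_ge -?leNgt ?bnd_simp -?ltNge// Rintegral_set0 subr0.
exact: Rintegral_ge0.
Qed.

Lemma energy_derive : {ae mu, forall x, 0 < x < T ->
  derivable energy x 1 /\ 'D_1 energy x = g x ^+ 2}.
Proof.
have : locally_integrable setT ((fun t => g t ^+ 2) \_ `[0%R, T]).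
  exact: integrable_locally_restrict.
move=> /(@FTC1 R ((fun t => g t ^+ 2) \_ `[0, T]) (BLeft 0)) H.
have := H (fun y => intrS (measurable_itv _)).
apply: filterS; first exact: (ae_filter_ringOfSetsType mu).
move=> x + /andP[x0 xT]; rewrite lte_fin => /(_ x0)[dE]; rewrite derive1E => E.
split=> //; rewrite [LHS]E patchE mem_set//=.
by rewrite in_itv/= !ltW.
Qed.

Lemma energyE : (\int[mu]_(t in `[0%R, T]) (g t ^+ 2)%:E)%E =
  (energy T - energy 0)%:E.
Proof.
have -> : energy 0 = 0 by rewrite /energy set_itv1 Rintegral_set1.
rewrite subr0 /energy /Rintegral fineK; last first.
  by apply: integrable_fin_num => //; exact: intrS.
apply: eq_integral => t tT; rewrite patchE /=.
by rewrite tT.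
Qed.

(** By Young's inequality [|g|] is at most [g ^+ 2 / (2 * c) + c / 2], which is almost everywhere
    the derivative of the nondecreasing [G] below. The parameter [c] is left free for
    optimisation. *)
Lemma increment_le_energy (c a b : R) : 0 < c -> 0 <= a -> a <= b -> b <= T ->
  `|f b - f a| <= (2 * c)^-1 * (energy b - energy a) + c / 2 * (b - a).
Proof.
move=> c0 a0 ab bT.
have c2 : 0 < (2 * c)^-1 by rewrite invr_gt0 mulr_gt0.
pose G (x : R) := (2 * c)^-1 * energy x + c / 2 * x.
suff : `|f b - f a| <= G b - G a by rewrite /G; lra.
apply: (@ac_increment_le _ T) => // [s t s0 st tT|].
  rewrite /G lerD// ler_pM2l//; first exact: energy_homo.
  by rewrite divr_gt0.
have FF := ae_filter_ringOfSetsType mu.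
apply: filterS2 dfg energy_derive => /= x + + x0T; move=> /(_ _)[|df Df].
  by case/andP: x0T => ? ?; rewrite in_itv/= !ltW.
move=> /(_ x0T)[dE DE].
have [dG DG] := derive_affine_comb (2 * c)^-1 (c / 2) dE.
split; [exact: df|exact: dG|rewrite DG DE Df].
have : 0 <= (`|g x| - c) ^+ 2 by exact: sqr_ge0.
rewrite -(ler_pM2l c2) mulr0 => H.
suff : (2 * c)^-1 * (`|g x| - c) ^+ 2 = (2 * c)^-1 * g x ^+ 2 + c / 2 - `|g x| by lra.
rewrite sqrrB -(real_normK (num_real (g x))); field.
by rewrite gt_eqF.
Qed.

(** The choice [c = |f b - f a| / (b - a)] makes the linear term half of the left-hand side, and
    what remains is Cauchy-Schwarz. *)
Lemma sqr_increment_le_energy (a b : R) : 0 <= a -> a <= b -> b <= T ->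
  (f b - f a) ^+ 2 <= (b - a) * (energy b - energy a).
Proof.
move=> a0; rewrite le_eqVlt => /predU1P[->|ab] bT.
  by rewrite !subrr mulr0 expr0n.
rewrite -(real_normK (num_real _)).
have [->|D0] := eqVneq `|f b - f a| 0.
  by rewrite expr0n/= mulr_ge0 ?subr_ge0 ?energy_homo// ltW.
have D1 : 0 < `|f b - f a| by rewrite lt_neqAle eq_sym D0 normr_ge0.
have ba : 0 < b - a by rewrite subr_gt0.
have := increment_le_energy (divr_gt0 D1 ba) a0 (ltW ab) bT.
set D := `|_|; set E := energy b - energy a => H.
have : D * D <= ((2 * (D / (b - a)))^-1 * E + D / (b - a) / 2 * (b - a)) * D.
  by rewrite ler_pM2r.
have -> : ((2 * (D / (b - a)))^-1 * E + D / (b - a) / 2 * (b - a)) * D =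
  (b - a) * E / 2 + D * D / 2.
  by field; rewrite !gt_eqF.
rewrite expr2; lra.
Qed.

End SquareIntegrableDerivative.

(** The lower limit is the supremum of the tail infima, so one of these already exceeds [l]. *)
Lemma lt_limn_einf_near (u : (\bar R)^nat) (l : \bar R) : (l < limn_einf u)%E ->
  \forall k \near \oo, (l < u k)%E.
Proof.
rewrite limn_einf_lim.
have /cvg_lim -> // := @ereal_nondecreasing_cvgn R _ (@nondecreasing_einfs _ u).
move=> /ereal_sup_gt[_ [n _ <-] ln]; exists n => // k /= nk.
by apply: lt_le_trans ln _; apply: ereal_inf_lbound; exists k.
Qed.

(** On [A] every preimage is finite, hence measurable. Used with the mesh points as [A], where a
    piecewise linear function may fail to be differentiable. *)
Lemma measurable_fun_finite_diff (D A : set R) (f g : R -> R) :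
  measurable D -> finite_set A -> (forall t, D t -> ~ A t -> f t = g t) ->
  measurable_fun D f -> measurable_fun D g.
Proof.
move=> mD fA fg mf.
have fin_meas (B : set R) : finite_set B -> measurable B.
  by move=> fB; apply: countable_measurable; [exact: measurable_set1|
     exact: finite_set_countable].
have mA := fin_meas _ fA.
rewrite -(setUIDK D A); apply/measurable_funU; [exact: measurableI|
  exact: measurableD|split].
  move=> _ Y mY; apply: fin_meas; apply: sub_finite_set fA => x [[]]//.
apply: (eq_measurable_fun f) => [t|].
  by rewrite inE => -[]; exact: fg.
by apply: measurable_funS mf => //; exact: subDsetl.
Qed.

(** * Step functions on the mesh *)

Section StepFunction.
Variables (T : R) (k : nat).
Hypotheses (T0 : 0 < T).
Implicit Type c : nat -> R.

Definition stepf c (t : R) : R :=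
  \sum_(0 <= j < k) c j * \1_`[mesh T k j, mesh T k j.+1[ t.

Lemma stepf_in c j t : (j < k)%N -> mesh T k j <= t < mesh T k j.+1 ->
  stepf c t = c j.
Proof.
move=> jk /andP[jt tj]; rewrite /stepf big_mkord (bigD1 (Ordinal jk))//=.
rewrite big1 ?addr0.
  by rewrite indicE mem_set ?mulr1//= in_itv/= jt.
move=> i ij; rewrite indicE memNset ?mulr0//= in_itv/= => /andP[it ti].
move: ij; rewrite -val_eqE/= neq_ltn => /orP[ij|ji].
  by have := le_mesh k T0 ij; lra.
by have := le_mesh k T0 ji; lra.
Qed.

(** The index does not depend on [c], so pointwise operations such as squaring pass to the
    coefficients. *)
Lemma stepf_cases t : (exists2 j, (j < k)%N & forall c, stepf c t = c j) \/
  (forall c, stepf c t = 0).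
Proof.
have [[j jk tj]|H] := pselect (exists2 j, (j < k)%N & mesh T k j <= t < mesh T k j.+1).
  by left; exists j => // c; exact: stepf_in.
right=> c; rewrite /stepf big_nat big1// => j /andP[_ jk].
rewrite indicE memNset ?mulr0//= in_itv/= => tj; apply: H; by exists j.
Qed.

Lemma measurable_stepf c : measurable_fun setT (stepf c).
Proof.
rewrite /stepf; apply: measurable_sum => j.
by apply: measurable_funM => //; exact: measurable_indic.
Qed.

Lemma integral_stepf c : (0 < k)%N -> (forall j, 0 <= c j) ->
  (\int[mu]_(t in `[0%R, T]) (stepf c t)%:E =
   (\sum_(0 <= j < k) step T k * c j)%:E)%E.
Proof.
move=> k0 c0; rewrite /stepf.
under eq_integral => t _ do rewrite -sumEFin.
rewrite ge0_integral_sum//; last 2 first.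
- move=> j; apply/measurable_EFinP; apply: measurable_funM => //.
- by move=> j t _; rewrite lee_fin mulr_ge0.
rewrite -sumEFin !big_nat; apply: eq_bigr => j /andP[_ jk].
under eq_integral => t _ do rewrite EFinM.
rewrite ge0_integralZl//; last 2 first.
- by apply/measurable_EFinP; exact: measurable_funTS.
- by rewrite lee_fin.
rewrite integral_indic// setIidl; last first.
  move=> t; rewrite /= !in_itv/= => /andP[jt tj].
  rewrite (le_trans (mesh_ge0 k j T0) jt)/= (le_trans (ltW tj))//.
  exact: mesh_le.
rewrite [X in (_ * X)%E]lebesgue_measure_itv/= lte_fin lt_mesh//.
by rewrite -EFinB -EFinM meshS addrAC subrr add0r mulrC.
Qed.

End StepFunction.

Definition real_diffq (T : R) (k : nat) (f : R -> R) (j : nat) : R :=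
  (step T k)^-1 * (f (mesh T k j.+1) - f (mesh T k j)).

Lemma near_step_lt (T r : R) : 0 < T -> 0 < r ->
  \forall k \near \oo, (0 < k)%N /\ step T k < r.
Proof.
move=> T0 r0; near=> k.
have k0 : (0 < k)%N by near: k; exact: nbhs_infty_gt.
split => //; rewrite /step ltr_pdivrMr ?ltr0n// -ltr_pdivrMl//.
by near: k; exact: nbhs_infty_gtr.
Unshelve. all: by end_near. Qed.

Lemma mesh_cover_lt (T : R) (k : nat) (t : R) : 0 < T -> (0 < k)%N ->
  0 <= t < T -> exists2 j, (j < k)%N & mesh T k j <= t < mesh T k j.+1.
Proof.
move=> T0 k0 /andP[t0 tT].
have /(mesh_cover T0 k0)[j jk /andP[jt]] : 0 <= t <= T by rewrite t0 ltW.
rewrite le_eqVlt => /predU1P[tj|tj]; last by exists j => //; rewrite jt.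
(* A [t] at the right end belongs to the next half-open interval, which exists because [t < T]. *)
exists j.+1; last by rewrite -tj lexx /= tj lt_mesh.
rewrite ltn_neqAle jk andbT; apply: contraTneq tT => jE.
by rewrite tj jE mesh_last// ltxx.
Qed.

(** The quotient is taken over an interval containing [t]: the expansion errors at its two ends are
    at most [e] times distances that add up to the step. *)
Lemma stepf_diffq_cvg (T : R) (f : R -> R) (t : R) : 0 < T -> 0 <= t < T ->
  derivable f t 1 -> stepf T k (real_diffq T k f) t @[k --> \oo] --> 'D_1 f t.
Proof.
move=> T0 tT df; apply/cvgrPdist_le => e e0.
have [r r0 fr] := derivable_near df e0.
apply: filterS (near_step_lt T0 r0) => k [k0 hr].
have [j jk /andP[jt tj]] := mesh_cover_lt T0 k0 tT.
rewrite (@stepf_in _ _ T0 _ j)// ?jt//.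
have h0 := step_gt0 T0 k0.
have mS := meshS T k j.
have := fr (mesh T k j); have := fr (mesh T k j.+1).
have -> : `|mesh T k j.+1 - t| = mesh T k j.+1 - t by rewrite ger0_norm// subr_ge0 ltW.
have -> : `|mesh T k j - t| = t - mesh T k j by rewrite distrC ger0_norm// subr_ge0.
move=> /(_ ltac:(lra)) fj1 /(_ ltac:(lra)) fj.
rewrite /real_diffq.
set F1 := f (mesh T k j.+1) in fj1 *; set F0 := f (mesh T k j) in fj *.
rewrite distrC -(ler_pM2r h0) -{2}(ger0_norm (ltW h0)) -normrM mulrBl.
rewrite mulrAC mulVf ?gt_eqF// mul1r.
have -> : F1 - F0 - 'D_1 f t * step T k =
  (F1 - f t - 'D_1 f t * (mesh T k j.+1 - t)) - (F0 - f t - 'D_1 f t * (mesh T k j - t)).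
  by rewrite mS; ring.
apply: le_trans (ler_normB _ _) _.
apply: le_trans (lerD fj1 fj) _; rewrite mS; lra.
Qed.

End ScalarSobolev.

(** * Convergence in [L^2] of scalar difference quotients *)

Section ScalarL2.
Variable R : realType.
Local Notation mu := (@lebesgue_measure R).
Variables (T : R) (f g : R -> R).
Hypotheses (T0 : 0 < T) (acf : ac_real T f).
Hypothesis dfg : {ae mu, forall t, t \in `[0, T] ->
  derivable f t 1 /\ 'D_1 f t = g t}.
Hypothesis mg : measurable_fun `[0, T] g.
Hypothesis g2 : (\int[mu]_(t in `[0%R, T]) (g t ^+ 2)%:E < +oo)%E.

Let s k := stepf T k (real_diffq T k f).
Let I := energy T g T - energy T g 0.

Let ms k : measurable_fun `[0, T] (s k).
Proof. by apply: measurable_funTS; exact: measurable_stepf. Qed.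

Let sqr_s k t : s k t ^+ 2 = stepf T k (fun j => real_diffq T k f j ^+ 2) t.
Proof.
rewrite /s; have [[j jk E]|E] := stepf_cases k T0 t; first by rewrite !E.
by rewrite !E expr0n.
Qed.

(** Cauchy-Schwarz on each mesh interval, after which the energies telescope to [I]. *)
Let energy_mesh k : (0 < k)%N ->
  \sum_(0 <= j < k) step T k * real_diffq T k f j ^+ 2 <= I.
Proof.
move=> k0; have := telescope_sumr (fun j => energy T g (mesh T k j)) (leq0n k).
rewrite mesh_last// mesh0 -/I => <-.
rewrite !big_nat; apply: ler_sum => j /andP[_ jk].
have h0 := step_gt0 T0 k0.
have := sqr_increment_le_energy acf dfg mg g2 (mesh_ge0 k j T0)
  (le_mesh k T0 (leqnSn j)) (mesh_le T0 k0 jk).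
have -> : mesh T k j.+1 - mesh T k j = step T k by rewrite meshS; ring.
move=> H.
rewrite /real_diffq exprMn -(ler_pM2l h0); apply: le_trans H.
by rewrite le_eqVlt; apply/orP; left; apply/eqP; field; rewrite gt_eqF.
Qed.

Let int_s k : (\int[mu]_(t in `[0%R, T]) (s k t ^+ 2)%:E <= I%:E)%E.
Proof.
under eq_integral => t _ do rewrite sqr_s.
case: k => [|k]; last first.
  rewrite integral_stepf// ?lee_fin ?energy_mesh// => j.
  exact: sqr_ge0.
under eq_integral => t _ do rewrite /stepf big_geq//.
by rewrite integral0 lee_fin subr_ge0; apply: energy_homo => //; exact: ltW.
Qed.

(** The parallelogram identity, with both [s k] and [g] of squared norm at most [I]. *)
Let int_sum k : (\int[mu]_(t in `[0%R, T]) ((s k t - g t) ^+ 2)%:E +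
  \int[mu]_(t in `[0%R, T]) ((s k t + g t) ^+ 2)%:E <= (4 * I)%:E)%E.
Proof.
have mI : measurable `[0, T] by [].
have m1 : measurable_fun `[0, T] (fun t => ((s k t - g t) ^+ 2)%:E).
  by apply/measurable_EFinP/measurable_funX/measurable_funB.
have m2 : measurable_fun `[0, T] (fun t => ((s k t + g t) ^+ 2)%:E).
  by apply/measurable_EFinP/measurable_funX/measurable_funD.
have m3 : measurable_fun `[0, T] (fun t => (s k t ^+ 2)%:E).
  by apply/measurable_EFinP/measurable_funX.
have m4 : measurable_fun `[0, T] (fun t => (g t ^+ 2)%:E).
  by apply/measurable_EFinP/measurable_funX.
rewrite -ge0_integralD//; [|by move=> t _; rewrite lee_fin sqr_ge0..].
under eq_integral => t _.
  rewrite -EFinD (_ : _ + _ = 2 * (s k t ^+ 2 + g t ^+ 2)); last by ring.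
  rewrite EFinM [X in (_ * X)%E]EFinD; over.
rewrite ge0_integralZl//; last 2 first.
- exact: emeasurable_funD.
- by move=> t _; rewrite -EFinD lee_fin addr_ge0 ?sqr_ge0.
rewrite ge0_integralD//; [|by move=> t _; rewrite lee_fin sqr_ge0..].
rewrite (energyE mg g2) -/I.
have -> : (4 * I)%:E = (2%:E * (I%:E + I%:E))%E.
  by rewrite -EFinD -EFinM; congr EFin; ring.
by rewrite lee_pmul2l// leeD2r.
Qed.

Let fatou_s :
  ((4 * I)%:E <= limn_einf (fun k => \int[mu]_(t in `[0%R, T]) ((s k t + g t) ^+ 2)%:E))%E.
Proof.
have mI : measurable `[0, T] by [].
have m2 k : measurable_fun `[0, T] (fun t => ((s k t + g t) ^+ 2)%:E).
  by apply/measurable_EFinP/measurable_funX/measurable_funD.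
have := @fatou _ _ _ mu _ mI (fun k t => ((s k t + g t) ^+ 2)%:E) m2.
move=> /(_ (fun k t _ => sqr_ge0 _)); apply: le_trans.
have -> : (4 * I)%:E = (\int[mu]_(t in `[0%R, T]) (4 * g t ^+ 2)%:E)%E.
  under eq_integral => t _ do rewrite EFinM.
  rewrite ge0_integralZl//; last 2 first.
  - by apply/measurable_EFinP/measurable_funX.
  - by move=> t _; rewrite lee_fin sqr_ge0.
  by rewrite (energyE mg g2).
rewrite le_eqVlt; apply/orP; left; apply/eqP.
apply: ge0_ae_eq_integral => //.
- by apply/measurable_EFinP/measurable_funM => //; exact: measurable_funX.
- apply: measurableT_comp => //; apply: measurable_fun_limn_esup => k.
  exact: measurableT_comp (@oppe_measurable R setT) (m2 k).
- by move=> t _; rewrite lee_fin mulr_ge0 ?sqr_ge0.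
- move=> t _; rewrite limn_einf_lim; apply: lime_ge; first exact: is_cvg_einfs.
  apply: nearW => k; apply: le_ereal_inf_tmp => _ [j _ <-].
  by rewrite lee_fin sqr_ge0.
have FF := ae_filter_ringOfSetsType mu.
(* [T] lies in none of the half-open mesh intervals. *)
have nT : {ae mu, forall t, t != T}.
  apply: negligibleS (negligible_finite (finite_set1 T)) => t /= /negP.
  by rewrite negbK => /eqP.
apply: filterS2 dfg nT => t /= H tT tI; have [df Df] := H tI.
have t0T : 0 <= t < T.
  by move: tI; rewrite /= in_itv/= => /andP[-> tT']; rewrite lt_neqAle tT.
have cs := stepf_diffq_cvg T0 t0T df.
rewrite Df in cs.
have : ((s k t + g t) ^+ 2) @[k --> \oo] --> (g t + g t) ^+ 2.
  rewrite expr2; under eq_fun do rewrite expr2.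
  by apply: cvgM; apply: cvgD => //; exact: cvg_cst.
move=> cE; have : ((s k t + g t) ^+ 2)%:E @[k --> \oo] --> ((g t + g t) ^+ 2)%:E.
  by apply: cvg_EFin; [exact: nearW|exact: cE].
by move=> /cvg_limn_einf_sup[-> _]; congr EFin; ring.
Qed.

(** The integrals of [(s - g)^2] and [(s + g)^2] sum to at most [4 * I], while the second has lower
    limit at least [4 * I]; the first is squeezed to 0. *)
Lemma diffq_cvg_L2 :
  (\int[mu]_(t in `[0%R, T]) ((stepf T k (real_diffq T k f) t - g t) ^+ 2)%:E)%E
    @[k --> \oo] --> 0%E.
Proof.
set J := fun k => (\int[mu]_(t in `[0%R, T]) _)%E.
have J0 k : (0 <= J k)%E.
  by apply: integral_ge0 => t _; rewrite lee_fin sqr_ge0.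
set c := fun k => (\int[mu]_(t in `[0%R, T]) ((s k t + g t) ^+ 2)%:E)%E.
have c0 k : (0 <= c k)%E.
  by apply: integral_ge0 => t _; rewrite lee_fin sqr_ge0.
have Jc k : (J k + c k <= (4 * I)%:E)%E by exact: int_sum.
have Jfin k : J k \is a fin_num.
  rewrite ge0_fin_numE//; apply: le_lt_trans (ltry (4 * I)).
  by apply: le_trans (Jc k); rewrite leeDl.
have cfin k : c k \is a fin_num.
  rewrite ge0_fin_numE//; apply: le_lt_trans (ltry (4 * I)).
  by apply: le_trans (Jc k); rewrite leeDr.
apply/fine_cvgP; split; first exact: nearW.
apply/cvgrPdist_le => e e0.
have : ((4 * I - e)%:E < limn_einf c)%E.
  by apply: lt_le_trans fatou_s; rewrite lte_fin ltrBlDr ltrDl.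
move=> /lt_limn_einf_near; apply: filterS => k /= ck.
rewrite sub0r normrN ger0_norm ?fine_ge0//.
have := Jc k; move: ck; rewrite -(fineK (cfin k)) -(fineK (Jfin k)).
by rewrite -EFinD lte_fin lee_fin /=; lra.
Qed.

End ScalarL2.

(** * Matrix-valued functions *)

Section MatrixSobolev.
Variables (R : realType) (p q : nat).
Local Notation mu := (@lebesgue_measure R).
Implicit Types (f : R -> 'M[R]_(p, q)) (c d : nat -> 'M[R]_(p, q)).

(** The uniform structure comes from the sup norm on matrices, which the Euclidean norm
    dominates. *)
Lemma uniform_cvg_enorm (T : R) (fk : nat -> R -> 'M[R]_(p, q)) f :
  (forall e : R, 0 < e -> \forall k \near \oo,
     forall t, 0 <= t <= T -> enorm (fk k t - f t) <= e) ->
  {uniform `[0, T], fk @ \oo --> f}.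
Proof.
move=> H P /uniform_nbhs[E [entE EP]].
move: entE; rewrite -entourage_ballE => -[e /= e0 eE].
have e20 : 0 < e / 2 by rewrite divr_gt0.
apply: filterS (H _ e20) => k Hk; apply: EP => t /=; rewrite in_itv/= => tT.
apply: eE; rewrite /= -ball_normE /ball_/= distrC.
apply: le_lt_trans (ler_norm_enorm _) _; apply: le_lt_trans (Hk _ tT) _.
by rewrite ltr_pdivrMr// ltr_pMr// ltr1n.
Qed.

Lemma sqr_enormD_le (A B : 'M[R]_(p, q)) :
  enorm (A + B) ^+ 2 <= 2 * enorm A ^+ 2 + 2 * enorm B ^+ 2.
Proof.
rewrite !sqr_enorm !mulr_sumr -big_split/=; apply: ler_sum => i _.
rewrite !mulr_sumr -big_split/=; apply: ler_sum => j _.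
rewrite mxE; have := sqr_ge0 (A i j - B i j); rewrite sqrrB sqrrD; lra.
Qed.

(** For small increments both points stay in the same mesh interval, where the quotient is
    constant. *)
Lemma derive_plin (T : R) (k l : nat) a d (t : R) : 0 < T -> (l < k)%N ->
  mesh T k l < t < mesh T k l.+1 -> 'D_1 (plin T k a d) t = d l.
Proof.
move=> T0 lk /andP[lt tl].
apply/cvg_lim; first exact: norm_hausdorff.
apply: cvg_near_cst; near=> h.
have h0 : h != 0 by near: h; exact: nbhs_dnbhs_neq.
have hlt : `|h| < Num.min (t - mesh T k l) (mesh T k l.+1 - t).
  by near: h; apply: dnbhs0_lt; rewrite lt_min !subr_gt0 lt.
have [h1 h2] : `|h| < t - mesh T k l /\ `|h| < mesh T k l.+1 - t.
  by move: hlt; rewrite lt_min => /andP.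
have [h3 h4] := (ler_norm h, ler_norm (- h)); rewrite normrN in h4.
rewrite /= (_ : h *: 1 = h); last by rewrite /GRing.scale/= mulr1.
rewrite !(@plin_local _ _ _ T k a d l)//; last 2 first.
- by apply/andP; split; lra.
- by apply/andP; split; lra.
rewrite opprD addrACA subrr add0r -scalerBl.
have -> : h + t - mesh T k l - (t - mesh T k l) = h by ring.
by rewrite scalerA mulVf// scale1r.
Unshelve. all: by end_near. Qed.

Definition mesh_points (T : R) (k : nat) : set R := [set mesh T k l | l in `I_k.+1].

Lemma finite_mesh_points (T : R) (k : nat) : finite_set (mesh_points T k).
Proof. exact/finite_image/finite_II. Qed.

Lemma mesh_cover_open (T : R) (k : nat) (t : R) : 0 < T -> (0 < k)%N ->
  0 <= t <= T -> ~ mesh_points T k t ->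
  exists2 l, (l < k)%N & mesh T k l < t < mesh T k l.+1.
Proof.
move=> T0 k0 /(mesh_cover T0 k0)[l lk /andP[lt tl]] ntm; exists l => //.
rewrite !lt_neqAle lt tl !andbT; apply/andP; split; apply/eqP => E; apply: ntm.
  by exists l => //=; rewrite ltnS ltnW.
by exists l.+1 => //=.
Qed.

Lemma measurable_derive_plin (T : R) (k : nat) a d i j : 0 < T -> (0 < k)%N ->
  measurable_fun `[0, T] (fun t => 'D_1 (plin T k a d) t i j).
Proof.
move=> T0 k0; apply: (measurable_fun_finite_diff _ (finite_mesh_points T k)
    (f := stepf T k (fun l => d l i j))) => //.
  move=> t; rewrite /= in_itv/= => tT ntm.
  have [l lk /andP[lt tl]] := mesh_cover_open T0 k0 tT ntm.
  by rewrite (derive_plin _ _ T0 lk) ?lt// (stepf_in T0 _ lk)// tl ltW.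
by apply: measurable_funTS; exact: measurable_stepf.
Qed.

Section Entries.
Variables (T : R) (f : R -> 'M[R]_(p, q)).
Hypotheses (T0 : 0 < T) (Wf : W12 T f).

Let fij i j t := f t i j.
Let gij i j t := 'D_1 f t i j.

Lemma W12_entry_ac i j : ac_real T (fij i j).
Proof.
case: Wf => acf _ _ _ e e0; have [d d0 H] := acf e e0.
exists d => // s s1 s2 s3; apply: le_lt_trans (H s s1 s2 s3).
apply: ler_sum => I _; apply: le_trans (ler_entry_enorm _ i j).
by rewrite /fij !mxE.
Qed.

Lemma W12_entry_derive i j : {ae mu, forall t, t \in `[0, T] ->
  derivable (fij i j) t 1 /\ 'D_1 (fij i j) t = gij i j t}.
Proof.
case: Wf => _ df _ _; have FF := ae_filter_ringOfSetsType mu.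
apply: filterS df => t H /H dt.
split; first by have /derivable_mxP := dt; exact.
by rewrite /gij (derive_mx dt) mxE.
Qed.

Lemma W12_entry_measurable i j : measurable_fun `[0, T] (gij i j).
Proof. by case: Wf => _ _ mf _; exact: mf. Qed.

Lemma measurable_sqr_enorm (D : set R) (h : R -> 'M[R]_(p, q)) :
  (forall i j, measurable_fun D (fun t => h t i j)) ->
  measurable_fun D (fun t => (enorm (h t) ^+ 2)%:E).
Proof.
move=> mh; apply/measurable_EFinP; under eq_fun do rewrite sqr_enorm.
apply: measurable_sum => i; apply: measurable_sum => j.
exact: measurable_funX.
Qed.

Lemma W12_entry_energy i j :
  (\int[mu]_(t in `[0%R, T]) (gij i j t ^+ 2)%:E < +oo)%E.
Proof.
case: Wf => _ _ mf; apply: le_lt_trans; apply: ge0_le_integral => //.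
- by move=> t _; rewrite lee_fin sqr_ge0.
- apply/measurable_EFinP/measurable_funX; exact: mf.
- exact: measurable_sqr_enorm.
- move=> t _; rewrite lee_fin -(real_normK (num_real _)).
  by rewrite ler_pXn2r ?nnegrE ?enorm_ge0// ler_entry_enorm.
Qed.

(* Entrywise, |f_ij'| <= (|f_ij'|^2 + 1) / 2. *)
Lemma W12_majorant : exists G : R -> R,
  forall s t, 0 <= s -> s <= t -> t <= T -> enorm (f t - f s) <= G t - G s.
Proof.
exists (fun x => \sum_i \sum_j ((2 * 1)^-1 * energy T (gij i j) x + 1 / 2 * x)).
move=> s t s0 st tT; apply: le_trans (ler_enorm_entries _) _.
rewrite -sumrB; apply: ler_sum => i _; rewrite -sumrB; apply: ler_sum => j _.
have := increment_le_energy (W12_entry_ac i j) (W12_entry_derive i j)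
  (W12_entry_measurable i j) (W12_entry_energy i j) ltr01 s0 st tT.
by rewrite /fij !mxE; lra.
Qed.

Lemma W12_total_variation_lty : (etotal_variation T f < +oo)%E.
Proof.
by have [G /etotal_variation_le/le_lt_trans] := W12_majorant; apply; exact: ltry.
Qed.

Lemma W12_unif_cont (e : R) : 0 < e -> exists2 r : R, 0 < r &
  forall s t, 0 <= s <= T -> 0 <= t <= T -> `|s - t| < r -> enorm (f s - f t) < e.
Proof.
case: Wf => acf _ _ _ e0; have [r r0 H] := acf e e0; exists r => // s t.
wlog st : s t / s <= t => [W sT tT str|].
  have [/W|/ltW/W] := leP s t; first exact.
  by rewrite enormB distrC; apply.
move=> /andP[s0 _] /andP[_ tT] str; rewrite enormB.
have := H [:: (s, t)]; rewrite !big_seq1/= s0 st tT; apply => //.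
by rewrite -(ger0_norm (_ : 0 <= t - s)) ?subr_ge0// distrC.
Qed.

(** * Interpolants with perturbed slopes *)

Section Perturbation.
Variables (c : nat -> nat -> 'M[R]_(p, q)).
Hypothesis c_cvg0 :
  (\sum_(0 <= l < k) step T k * enorm (c k l) ^+ 2) @[k --> \oo] --> (0 : R).

(** A common form for the three approximations: only the perturbation [c] of the interpolation
    slopes differs. *)
Let fk k := plin T k (f 0) (fun l => diffq T k f l + c k l).

Lemma plin_perturb_mesh k l : (0 < k)%N -> (l <= k)%N ->
  fk k (mesh T k l) = f (mesh T k l) + step T k *: \sum_(0 <= i < l) c k i.
Proof.
move=> k0 lk; rewrite /fk plin_mesh// big_split/= scalerDr addrA; congr (_ + _).
have := telescope_sumr (fun i => f (mesh T k i)) (leq0n l); rewrite mesh0 => E.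
rewrite /diffq -scaler_sumr E scalerA mulfV ?step_neq0// scale1r.
by rewrite addrC subrK.
Qed.

(** From weighted squares to weighted norms: [|c|] is at most [e / (2 * T) + T / (2 * e) * |c|^2],
    and the steps add up to [T]. *)
Let sum_enorm_small e : 0 < e -> \forall k \near \oo,
  \sum_(0 <= l < k) step T k * enorm (c k l) <= e.
Proof.
move=> e0.
(* With this threshold the quadratic part contributes at most [e / 2], as does the constant part. *)
have eT : 0 < e ^+ 2 / T by rewrite divr_gt0// exprn_gt0.
move/cvgrPdist_le : c_cvg0 => /(_ _ eT).
apply: filterS2 (nbhs_infty_gt 0%N) => k k0.
rewrite sub0r normrN ger0_norm; last first.
  by apply: sumr_ge0 => l _; rewrite mulr_ge0 ?sqr_ge0 ?step_ge0.
set S := \sum_(_ <= _ < _) _ => SeT.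
apply: (@le_trans _ _ (e / 2 + T / (2 * e) * S)); last first.
  suff : T / (2 * e) * S <= T / (2 * e) * (e ^+ 2 / T).
    have -> : T / (2 * e) * (e ^+ 2 / T) = e / 2 by field; rewrite !gt_eqF.
    lra.
  by rewrite ler_pM2l// divr_gt0// mulr_gt0.
have -> : e / 2 = \sum_(0 <= l < k) step T k * (e / T / 2).
  rewrite sumr_const_nat subn0 -mulrnAl -[step T k *+ k]mulr_natl.
  by have := mesh_last T k0; rewrite /mesh => ->; field; rewrite gt_eqF.
rewrite mulr_sumr -big_split/=; apply: ler_sum => l _.
rewrite [X in _ <= _ + X]mulrCA -mulrDr ler_wpM2l ?step_ge0//.
have : 0 <= T / (2 * e) * (enorm (c k l) - e / T) ^+ 2.
  by rewrite mulr_ge0 ?sqr_ge0// divr_ge0 ?mulr_ge0// ltW.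
suff -> : T / (2 * e) * (enorm (c k l) - e / T) ^+ 2 =
  e / T / 2 + T / (2 * e) * enorm (c k l) ^+ 2 - enorm (c k l) by lra.
by field; rewrite !gt_eqF.
Qed.

Lemma plin_perturb_uniform : {uniform `[0, T], fk @ \oo --> f}.
Proof.
apply: uniform_cvg_enorm => e e0.
have e30 : 0 < e / 3 by rewrite divr_gt0.
have [r r0 fr] := W12_unif_cont e30.
apply: filterS2 (near_step_lt T0 r0) (sum_enorm_small e30) => k [k0 hr] ck t tT.
have [l lk /andP[lt tl]] := mesh_cover T0 k0 tT.
have h0 := step_gt0 T0 k0; have mS := meshS T k l.
rewrite /fk (@plin_local _ _ _ T k (f 0) _ l t) ?lt//.
have := plin_perturb_mesh k0 (ltnW lk).
rewrite /fk plin_mesh//; last exact: ltnW.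
rewrite -scaler_sumr => ->; rewrite scalerDr.
set w := (t - mesh T k l) / step T k.
have w01 : 0 <= w <= 1.
  apply/andP; split; last by rewrite ler_pdivrMr// mul1r; lra.
  by rewrite divr_ge0 ?subr_ge0 ?(ltW h0).
have -> : (t - mesh T k l) *: diffq T k f l = w *: (f (mesh T k l.+1) - f (mesh T k l)).
  by rewrite /diffq scalerA.
(* Three errors of at most [e / 3]: from [t] to the left node, the fraction [w] of the increment of
   [f], and the accumulated perturbation. *)
have addE (A B C D F : 'M[R]_(p, q)) : A + B + (C + D) - F = (A - F) + (C + (B + D)).
  by apply/matrixP => i j; rewrite !mxE; ring.
rewrite addE.
apply: le_trans (ler_enormD _ _) _.
have -> : e = e / 3 + (e / 3 + e / 3) by field.
apply: lerD.
  apply/ltW/fr => //; first by rewrite mesh_ge0// mesh_le// ltnW.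
  by rewrite distrC ger0_norm ?subr_ge0//; lra.
apply: le_trans (ler_enormD _ _) _; apply: lerD.
  case/andP: w01 => w0 w1; rewrite enormZ ger0_norm//.
  apply: (@le_trans _ _ (enorm (f (mesh T k l.+1) - f (mesh T k l)))).
    by rewrite ler_piMl ?enorm_ge0.
  apply/ltW/fr; rewrite ?mesh_ge0 ?mesh_le// 1?ltnW//.
  by rewrite mS addrC addKr ger0_norm ?ltW.
apply: le_trans ck.
(* The perturbation accumulated up to [t] involves only the terms of index at most [l], the last
   with weight [t - mesh T k l]. *)
rewrite [leRHS](@big_cat_nat _ _ _ l.+1)//= -[leLHS]addr0; apply: lerD; last first.
  by apply: sumr_ge0 => i _; rewrite mulr_ge0 ?enorm_ge0 ?step_ge0.
rewrite [leRHS]big_nat_recr//=; apply: le_trans (ler_enormD _ _) _; apply: lerD.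
  rewrite scaler_sumr; apply: le_trans (ler_enorm_sum _ _ _) _.
  by apply: ler_sum => i _; rewrite enormZ ger0_norm// step_ge0.
rewrite enormZ ger0_norm ?subr_ge0// ler_wpM2r ?enorm_ge0//; lra.
Qed.

Lemma measurable_derive_diff k : (0 < k)%N ->
  measurable_fun `[0, T] (fun t => (enorm ('D_1 (fk k) t - 'D_1 f t) ^+ 2)%:E).
Proof.
move=> k0; apply: measurable_sqr_enorm => i j.
rewrite (_ : (fun t => _) = (fun t => 'D_1 (fk k) t i j - 'D_1 f t i j)); last first.
  by apply/funext => t; rewrite !mxE.
apply: measurable_funB; [exact: measurable_derive_plin|].
exact: W12_entry_measurable.
Qed.

Let J i j k := (\int[mu]_(t in `[0%R, T])
  ((stepf T k (real_diffq T k (fij i j)) t - gij i j t) ^+ 2)%:E)%E.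

Let S k := \sum_(0 <= l < k) step T k * enorm (c k l) ^+ 2.

(** Off the mesh points the derivative is the difference quotient plus [c]. The square of a sum is
    at most twice the sum of the squares, and the Frobenius norm splits into entries. *)
Let integral_bound k : (0 < k)%N ->
  (\int[mu]_(t in `[0%R, T]) (enorm ('D_1 (fk k) t - 'D_1 f t) ^+ 2)%:E <=
   2%:E * ((S k)%:E + \sum_i \sum_j J i j k))%E.
Proof.
move=> k0.
pose F i j t := (stepf T k (real_diffq T k (fij i j)) t - gij i j t) ^+ 2.
pose C t := stepf T k (fun l => enorm (c k l) ^+ 2) t.
have mF i j : measurable_fun `[0, T] (F i j).
  apply/measurable_funX/measurable_funB; last exact: W12_entry_measurable.
  by apply: measurable_funTS; exact: measurable_stepf.
have mC : measurable_fun `[0, T] C.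
  by apply: measurable_funTS; exact: measurable_stepf.
have C0 t : 0 <= C t.
  rewrite /C; have [[l _ ->]|->//] := stepf_cases k T0 t; exact: sqr_ge0.
have F0 i j t : 0 <= F i j t by exact: sqr_ge0.
have mFi i : measurable_fun `[0, T] (fun t => (\sum_j F i j t)%:E).
  by apply/measurable_EFinP; apply: measurable_sum => j.
have mFF : measurable_fun `[0, T] (fun t => (\sum_i \sum_j F i j t)%:E).
  by apply/measurable_EFinP; apply: measurable_sum => i; apply: measurable_sum => j.
have Fi0 i t : 0 <= \sum_j F i j t by apply: sumr_ge0.
have -> : (2%:E * ((S k)%:E + \sum_i \sum_j J i j k) =
   \int[mu]_(t in `[0%R, T]) (2 * (C t + \sum_i \sum_j F i j t))%:E)%E.
  under [RHS]eq_integral => t _ do rewrite EFinM.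
  rewrite ge0_integralZl//; last 2 first.
  - apply/measurable_EFinP/measurable_funD => //; exact/measurable_EFinP.
  - by move=> t _; rewrite lee_fin addr_ge0// sumr_ge0.
  congr (_ * _)%E; under [RHS]eq_integral => t _ do rewrite EFinD.
  rewrite ge0_integralD//; last 3 first.
  - by move=> t _; rewrite lee_fin.
  - exact/measurable_EFinP.
  - by move=> t _; rewrite lee_fin sumr_ge0.
  congr (_ + _)%E.
    by rewrite /C integral_stepf// => l; exact: sqr_ge0.
  under [RHS]eq_integral => t _ do rewrite -sumEFin.
  rewrite ge0_integral_sum//; last by move=> i t _; rewrite lee_fin.
  apply: eq_bigr => i _; under [RHS]eq_integral => t _ do rewrite -sumEFin.
  rewrite ge0_integral_sum//.
  - by move=> j; apply/measurable_EFinP; exact: mF.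
  - by move=> j t _; rewrite lee_fin.
apply: ae_ge0_le_integral => //.
- by move=> t _; rewrite lee_fin sqr_ge0.
- exact: measurable_derive_diff.
- by move=> t _; rewrite lee_fin mulr_ge0// addr_ge0// sumr_ge0.
- apply/measurable_EFinP/measurable_funM => //; apply: measurable_funD => //.
  exact/measurable_EFinP.
have FF := ae_filter_ringOfSetsType mu.
have : {ae mu, forall t, ~ mesh_points T k t}.
  apply: negligibleS (negligible_finite (finite_mesh_points T k)) => t /=.
  exact: contrapT.
apply: filterS => t ntm; rewrite /= in_itv/= => tT.
have [l lk /andP[lt tl]] := mesh_cover_open T0 k0 tT ntm.
have lt' : mesh T k l <= t < mesh T k l.+1 by rewrite tl ltW.
rewrite lee_fin (derive_plin _ _ T0 lk) ?lt// -addrA (addrC (c k l)) addrA.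
rewrite [X in enorm X]addrC; apply: le_trans (sqr_enormD_le _ _) _.
rewrite mulrDr /C (stepf_in T0 _ lk lt') lerD2l ler_pM2l// sqr_enorm.
apply: ler_sum => i _; apply: ler_sum => j _.
by rewrite /F (stepf_in T0 _ lk lt') /real_diffq /fij /gij /diffq !mxE.
Qed.

Lemma plin_perturb_L2 :
  (\int[mu]_(t in `[0%R, T]) (enorm ('D_1 (fk k) t - 'D_1 f t) ^+ 2)%:E)%E
    @[k --> \oo] --> 0%E.
Proof.
have J0 i j k : (0 <= J i j k)%E.
  by apply: integral_ge0 => t _; rewrite lee_fin sqr_ge0.
have JJ : (\sum_i \sum_j J i j k)%E @[k --> \oo] --> 0%E.
  rewrite [X in _ --> X](_ : _ = \sum_(i < p) \sum_(j < q) (0 : \bar R))%E; last first.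
    by rewrite big1// => i _; rewrite big1.
  apply: cvg_nnesum => i _; first by apply: nearW => k; exact: sume_ge0.
  apply: cvg_nnesum => j _; first by apply: nearW => k; exact: J0.
  exact: diffq_cvg_L2 (W12_entry_ac i j) (W12_entry_derive i j)
    (W12_entry_measurable i j) (W12_entry_energy i j).
have SS : ((S k)%:E)%E @[k --> \oo] --> 0%E.
  by apply: cvg_EFin; [exact: nearW|exact: c_cvg0].
have B : (2%:E * ((S k)%:E + \sum_i \sum_j J i j k))%E @[k --> \oo] --> 0%E.
  rewrite [X in _ --> X](_ : _ = 2%:E * (0 + 0))%E; last by rewrite adde0 mule0.
  by apply: cvgeZl => //; apply: cvgeD.
apply: squeeze_cvge (cvg_cst 0%E) B.
apply: filterS (nbhs_infty_gt 0%N) => k k0; rewrite integral_bound// andbT.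
by apply: integral_ge0 => t _; rewrite lee_fin sqr_ge0.
Qed.

End Perturbation.
End Entries.
End MatrixSobolev.

(** * The discrete approximations *)

Section SweepingApproximation.
Variable R : realType.
Local Notation mu := (@lebesgue_measure R).

(** Adding [y *m u^T] to [b] adds the inner product of [u_i] and [y] to each [b_i], which translates
    the polyhedron by [y]; normal cones are invariant under translation. *)
Lemma sweepF_translate (n m : nat) (x y v : 'rV[R]_n) (u : 'M[R]_(m, n))
    (b : 'rV[R]_m) : sweepF x u b v -> sweepF (x + y) u (b + y *m u^T) v.
Proof.
move=> [w [Cx Nw] wv]; exists w => //; split.
  by move=> i; rewrite dotpE mulmxDl [leLHS]mxE [leRHS]mxE lerD2r -dotpE.
move=> z Cz; rewrite opprD addrA addrAC.
apply: Nw => i; have H : (z *m u^T) 0 i <= b 0 i + (y *m u^T) 0 i.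
  by have := Cz i; rewrite dotpE [leRHS]mxE.
rewrite dotpE mulmxBl.
have -> : (z *m u^T - y *m u^T) 0 i = (z *m u^T) 0 i - (y *m u^T) 0 i by rewrite !mxE.
by rewrite lerBlDr.
Qed.

(** The squared row norms sum to at most [m * a^2]; [m <= m^2] trades the factor [sqrt m] for the
    simpler [m]. *)
Lemma enorm_le_rows (n m : nat) (A : 'M[R]_(m, n)) (a : R) : 0 <= a ->
  (forall i, enorm (row i A) <= a) -> enorm A <= m%:R * a.
Proof.
move=> a0 Aa; rewrite -(@ler_pXn2r _ 2)// ?nnegrE ?mulr_ge0 ?enorm_ge0//.
apply: (@le_trans _ _ (\sum_(i < m) a ^+ 2)).
  rewrite sqr_enorm; apply: ler_sum => i _.
  have : enorm (row i A) ^+ 2 <= a ^+ 2.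
    by rewrite ler_pXn2r ?nnegrE ?enorm_ge0.
  rewrite sqr_enorm big_ord1; apply: le_trans.
  by apply: ler_sum => j _; rewrite mxE.
rewrite sumr_const card_ord exprMn -[leLHS]mulr_natl ler_wpM2r ?sqr_ge0//.
by rewrite -natrX ler_nat; case: (m) => // m'; rewrite expnS expn1 leq_pmulr.
Qed.

(** * Mesh indices delimiting the interval from [tau] to [T - tau] *)

Section MeshIndices.
Variables (T tau : R) (k : nat).
Hypotheses (T0 : 0 < T) (k0 : (0 < k)%N) (tau0 : 0 <= tau) (tauT : tau <= T).

Lemma jlow_le_mesh j : (jlow T k tau <= j)%N -> tau <= mesh T k j.
Proof.
move=> lj; apply: le_trans (le_mesh k T0 lj); rewrite /jlow.
(* The search succeeds since the last mesh point is [T]. *)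
have has_low : has (fun j => tau <= mesh T k j) (iota 0 k.+1).
  by apply/hasP; exists k; rewrite ?mem_iota//= mesh_last.
have := nth_find 0%N has_low; rewrite nth_iota// -[X in (_ < X)%N](size_iota 0).
by rewrite -has_find.
Qed.

Lemma lt_jlow_mesh j : (j <= k)%N -> (j < jlow T k tau)%N -> mesh T k j < tau.
Proof.
move=> jk /(before_find 0%N); rewrite nth_iota// add0n => /negbT.
by rewrite -ltNge.
Qed.

Lemma jhigh_le : (jhigh T k tau <= k)%N.
Proof. by apply/bigmax_leqP => i _; rewrite -ltnS. Qed.

Lemma le_jhigh_mesh j : (j <= jhigh T k tau)%N -> mesh T k j <= T - tau.
Proof.
move=> jh; apply: le_trans (le_mesh k T0 jh) _; rewrite /jhigh.
(* Index 0 qualifies, so the maximum is attained and is not the default of an empty one. *)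
have P0 : mesh T k (@ord0 k) <= T - tau by rewrite mesh0 subr_ge0.
by have [|i Pi ->] := @eq_bigmax_cond _ [pred i : 'I_k.+1 | mesh T k i <= T - tau] val;
  [apply/card_gt0P; exists ord0|].
Qed.

Lemma jhigh_lt_mesh j : (j <= k)%N -> (jhigh T k tau < j)%N -> T - tau < mesh T k j.
Proof.
move=> jk; rewrite ltnNge => hj; rewrite ltNge; apply: contra hj => jT.
have jk' : (j < k.+1)%N by [].
exact: (@leq_bigmax_cond _ _ (fun i : 'I_k.+1 => val i) (Ordinal jk')).
Qed.

End MeshIndices.

(** The mesh is one of the partitions in the supremum; finiteness makes [fine] return the actual
    variation. *)
Lemma sum_mesh_le_variation (p q : nat) (T : R) (f : R -> 'M[R]_(p, q)) (k : nat) :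
  0 < T -> (0 < k)%N -> (etotal_variation T f < +oo)%E ->
  \sum_(0 <= j < k) enorm (f (mesh T k j.+1) - f (mesh T k j)) <=
  fine (etotal_variation T f).
Proof.
move=> T0 k0 Vfin; pose s := [seq mesh T k j.+1 | j <- iota 0 k].
have nths i : (i <= k)%N -> nth T (0 :: s) i = mesh T k i.
  case: i => [|i] ik /=; first by rewrite mesh0.
  by rewrite (nth_map 0%N) ?size_iota// nth_iota.
have sP : itv_partition 0 T s.
  split; last first.
    rewrite (last_nth T) size_map size_iota nths// mesh_last//.
  apply/(pathP T) => i; rewrite size_map size_iota => ik.
  by rewrite -[nth T s i]/(nth T (0 :: s) i.+1) !nths// 1?ltnW// lt_mesh.
have H : ((evariation T f s)%:E <= etotal_variation T f)%E.
  by apply: ereal_sup_ubound; exists s.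
have V0 : \sum_(0 <= j < k) enorm (f (mesh T k j.+1) - f (mesh T k j)) = evariation T f s.
  rewrite /evariation size_map size_iota; apply: eq_big_nat => i /andP[_ ik].
  by rewrite -(nths i.+1)// -(nths i)// ltnW.
rewrite V0 -lee_fin fineK// fin_numE gt_eqF/=; last first.
  by apply: lt_le_trans H; exact: ltNyr.
by rewrite lt_eqF.
Qed.

(** Each [c j] occurs in at most two increments, so summable slopes have bounded variation. *)
Lemma sum_increments_le (p q : nat) (c : nat -> 'M[R]_(p, q)) (k : nat) :
  \sum_(0 <= j < k.-1) enorm (c j.+1 - c j) <= 2 * \sum_(0 <= j < k) enorm (c j).
Proof.
case: k => [|k]; first by rewrite !big_geq// mulr0.
apply: (@le_trans _ _ (\sum_(0 <= j < k) enorm (c j.+1) + \sum_(0 <= j < k) enorm (c j))).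
  by rewrite -big_split; apply: ler_sum => j _; exact: ler_enormB.
rewrite mulrDl mul1r; apply: lerD.
  by rewrite [leRHS]big_nat_recl//= lerDr enorm_ge0.
by rewrite [leRHS]big_nat_recr//= lerDl enorm_ge0.
Qed.

(** * The approximating triple and its estimates *)

Section Construction.
Variables (n m : nat) (T tau : R) (x0 : 'rV[R]_n).
Variables (x : R -> 'rV[R]_n) (u : R -> 'M[R]_(m, n)) (b : R -> 'rV[R]_m) (M : R).
Hypotheses (T0 : 0 < T) (tau0T : 0 <= tau <= T).
Hypothesis feas : feasible T x0 tau x u b.
Hypotheses (Wx : W12 T x) (Wu : W12 T u) (Wb : W12 T b).
Hypothesis mesh_incl : forall k j, (j < k)%N ->
  sweepF (x (mesh T k j)) (u (mesh T k j)) (b (mesh T k j))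
    (mesh_derive x (mesh T k j)).
Hypothesis mesh_L2 : (\sum_(0 <= j < k)
     step T k * enorm (diffq T k x j - mesh_derive x (mesh T k j)) ^+ 2)
    @[k --> \oo] --> (0 : R).
Hypothesis M0 : 0 < M.
Hypothesis bounds : forall k, (0 < k)%N ->
  [/\ \sum_(0 <= j < k) enorm (diffq T k x j - mesh_derive x (mesh T k j)) <= M,
      enorm (diffq T k u 0) <= M,
      enorm (diffq T k b 0) <= M,
      \sum_(0 <= j < k.-1) enorm (diffq2 T k u j) <= M &
      \sum_(0 <= j < k.-1) enorm (diffq2 T k b j) <= M].

Definition slope_defect k j := mesh_derive x (mesh T k j) - diffq T k x j.

Definition defect_sum k j := \sum_(0 <= i < j) slope_defect k i.

(* Slope of the correction (x^k - x) *m u^T that moves the polyhedron along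
   with x^k; here x^k - x = step * defect_sum at the mesh points. *)
Definition shift_slope k j : 'rV[R]_m :=
  defect_sum k j.+1 *m (u (mesh T k j.+1))^T - defect_sum k j *m (u (mesh T k j))^T.

Let U : R := m%:R * (3 / 2).

(** The slope simplifies to [mesh_derive x (mesh T k j)]. It is written as a perturbed difference
    quotient, and [u_approx] with a zero perturbation, so that the results on perturbed slopes apply
    to all three functions. *)
Definition x_approx k := plin T k (x 0) (fun j => diffq T k x j + slope_defect k j).
Definition u_approx k := plin T k (u 0) (fun j => diffq T k u j + 0).
Definition b_approx k := plin T k (b 0) (fun j => diffq T k b j + shift_slope k j).

Let sum_slope_defect k : (0 < k)%N ->
  \sum_(0 <= j < k) enorm (slope_defect k j) <= M.
Proof.
move=> k0; have [H _ _ _ _] := bounds k0; apply: le_trans H.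
by apply: ler_sum => j _; rewrite enormB.
Qed.

Let enorm_defect_sum k j : (0 < k)%N -> (j <= k)%N -> enorm (defect_sum k j) <= M.
Proof.
move=> k0 jk; apply: le_trans (ler_enorm_sum _ _ _) _.
apply: le_trans (sum_slope_defect k0).
rewrite [leRHS](@big_cat_nat _ _ _ j)//= lerDl.
by apply: sumr_ge0 => i _; exact: enorm_ge0.
Qed.

Let slope_defect_le k j : (j < k)%N -> enorm (slope_defect k j) <= M.
Proof.
move=> jk; apply: le_trans (sum_slope_defect (leq_ltn_trans (leq0n j) jk)).
rewrite big_mkord (bigD1 (Ordinal jk))//= lerDl.
by apply: sumr_ge0 => i _; exact: enorm_ge0.
Qed.

Let enorm_u t : 0 <= t <= T -> enorm (u t) <= U.
Proof.
case: feas => _ _ _ u1 u2 /andP[t0 tT]; apply: enorm_le_rows => // i.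
have [tt|tt] := ltP t tau.
  suff /(u2 i)/andP[] : (t \in `[0, tau[) || (t \in `]T - tau, T]) by [].
  by rewrite !in_itv/= t0 tt.
have [Tt|Tt] := ltP (T - tau) t.
  suff /(u2 i)/andP[] : (t \in `[0, tau[) || (t \in `]T - tau, T]) by [].
  by rewrite !in_itv/= Tt tT orbT.
by rewrite u1 ?in_itv/= ?tt//; lra.
Qed.

(** Discrete product rule: the increment of a product is [defect_sum] times the increment of [u]
    plus [slope_defect] times [u]. *)
Let enorm_shift_slope k j : (j < k)%N ->
  enorm (shift_slope k j) <=
  M * enorm (u (mesh T k j.+1) - u (mesh T k j)) + U * enorm (slope_defect k j).
Proof.
move=> jk; have k0 := leq_ltn_trans (leq0n j) jk.
have -> : shift_slope k j =
    defect_sum k j.+1 *m (u (mesh T k j.+1) - u (mesh T k j))^T +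
    slope_defect k j *m (u (mesh T k j))^T.
  have -> : slope_defect k j = defect_sum k j.+1 - defect_sum k j.
    by rewrite /defect_sum big_nat_recr//= addrC addrK.
  by rewrite /shift_slope raddfB/= mulmxBr mulmxBl addrA subrK.
apply: le_trans (ler_enormD _ _) _; apply: lerD.
  apply: le_trans (ler_enorm_mulmx_tr _ _) _.
  by rewrite ler_wpM2r ?enorm_ge0// enorm_defect_sum.
apply: le_trans (ler_enorm_mulmx_tr _ _) _.
rewrite mulrC ler_wpM2r ?enorm_ge0// enorm_u//.
by rewrite mesh_ge0// mesh_le// ltnW.
Qed.

Let V := fine (etotal_variation T u).

(** Here the variation of [u] enters the constant: it bounds the summed increments of [u] at the
    nodes. *)
Let sum_shift_slope k : (0 < k)%N ->
  \sum_(0 <= j < k) enorm (shift_slope k j) <= M * V + U * M.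
Proof.
move=> k0; apply: (@le_trans _ _ (\sum_(0 <= j < k)
    (M * enorm (u (mesh T k j.+1) - u (mesh T k j)) + U * enorm (slope_defect k j)))).
  by rewrite !big_nat; apply: ler_sum => j /andP[_ jk]; exact: enorm_shift_slope.
rewrite big_split/= -!mulr_sumr; apply: lerD.
  by rewrite ler_pM2l//; apply: sum_mesh_le_variation => //; exact: W12_total_variation_lty.
by rewrite ler_wpM2l ?mulr_ge0// sum_slope_defect.
Qed.

Lemma slope_defect_cvg0 :
  (\sum_(0 <= j < k) step T k * enorm (slope_defect k j) ^+ 2) @[k --> \oo] --> (0 : R).
Proof.
apply: cvg_trans mesh_L2; apply: near_eq_cvg; apply: nearW => k.
by apply: eq_bigr => j _; rewrite enormB.
Qed.

Let sum_increments_cvg0 :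
  (\sum_(0 <= j < k) step T k * enorm (u (mesh T k j.+1) - u (mesh T k j)) ^+ 2)
    @[k --> \oo] --> (0 : R).
Proof.
apply/cvgrPdist_le => e e0.
(* The bound 1 makes the square of an increment at most the increment, and [e / T] sums to [e]
   against the steps. *)
pose e' := Num.min 1 (e / T).
have e'0 : 0 < e' by rewrite lt_min ltr01 divr_gt0.
have [r r0 ur] := W12_unif_cont Wu e'0.
apply: filterS (near_step_lt T0 r0) => k [k0 hr].
have h0 := step_gt0 T0 k0.
rewrite sub0r normrN ger0_norm; last first.
  by apply: sumr_ge0 => l _; rewrite mulr_ge0 ?sqr_ge0 ?step_ge0.
have -> : e = \sum_(0 <= j < k) step T k * (e / T).
  rewrite sumr_const_nat subn0 -mulrnAl -[step T k *+ k]mulr_natl.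
  by have := mesh_last T k0; rewrite /mesh => ->; field; rewrite gt_eqF.
rewrite !big_nat; apply: ler_sum => j /andP[_ jk]; rewrite ler_pM2l//.
have : enorm (u (mesh T k j.+1) - u (mesh T k j)) < e'.
  apply: ur; rewrite ?mesh_ge0 ?mesh_le// 1?ltnW//.
  by rewrite meshS addrC addKr ger0_norm ?ltW.
rewrite lt_min => /andP[D1 De]; apply: le_trans (ltW De).
by rewrite expr2 ler_piMl ?enorm_ge0// ltW.
Qed.

Lemma shift_slope_cvg0 :
  (\sum_(0 <= j < k) step T k * enorm (shift_slope k j) ^+ 2) @[k --> \oo] --> (0 : R).
Proof.
have H : (2 * M ^+ 2 * (\sum_(0 <= j < k)
       step T k * enorm (u (mesh T k j.+1) - u (mesh T k j)) ^+ 2) +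
    2 * U ^+ 2 * (\sum_(0 <= j < k) step T k * enorm (slope_defect k j) ^+ 2))
    @[k --> \oo] --> (0 : R).
  rewrite [X in _ --> X](_ : _ = 2 * M ^+ 2 * 0 + 2 * U ^+ 2 * 0); last by rewrite !mulr0 addr0.
  by apply: cvgD; apply: cvgMr; [exact: sum_increments_cvg0|exact: slope_defect_cvg0].
apply: squeeze_cvgr (cvg_cst 0) H.
apply: filterS (nbhs_infty_gt 0%N) => k k0; apply/andP; split.
  by apply: sumr_ge0 => l _; rewrite mulr_ge0 ?sqr_ge0 ?step_ge0.
rewrite !mulr_sumr -big_split/= !big_nat; apply: ler_sum => j /andP[_ jk].
rewrite !(mulrCA _ (step T k)) -mulrDr ler_wpM2l ?step_ge0//.
set D := enorm (u _ - _); set C := enorm (slope_defect k j).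
have := enorm_shift_slope jk; rewrite -/D -/C => H1.
apply: (@le_trans _ _ ((M * D + U * C) ^+ 2)).
  rewrite ler_pXn2r ?nnegrE ?enorm_ge0//; exact: le_trans (enorm_ge0 _) H1.
have := sqr_ge0 (M * D - U * C); rewrite sqrrB sqrrD !exprMn; lra.
Qed.

Lemma enorm0_cvg0 (p q : nat) :
  (\sum_(0 <= j < k) step T k * enorm (0 : 'M[R]_(p, q)) ^+ 2) @[k --> \oo] --> (0 : R).
Proof.
apply: cvg_near_cst; apply: nearW => k; apply: big1 => j _.
by rewrite enorm0 expr0n mulr0.
Qed.

Lemma x_approx_mesh k j : (0 < k)%N -> (j <= k)%N ->
  x_approx k (mesh T k j) = x (mesh T k j) + step T k *: defect_sum k j.
Proof. exact: plin_perturb_mesh. Qed.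

Lemma u_approx_mesh k j : (0 < k)%N -> (j <= k)%N ->
  u_approx k (mesh T k j) = u (mesh T k j).
Proof.
move=> k0 jk; rewrite /u_approx (plin_perturb_mesh _ T0 (fun _ _ => 0) k0 jk).
by rewrite big1// scaler0 addr0.
Qed.

(** The shift slopes telescope, starting from the empty [defect_sum k 0 = 0]. *)
Lemma b_approx_mesh k j : (0 < k)%N -> (j <= k)%N ->
  b_approx k (mesh T k j) =
  b (mesh T k j) + (step T k *: defect_sum k j) *m (u (mesh T k j))^T.
Proof.
move=> k0 jk; rewrite /b_approx (plin_perturb_mesh _ T0 shift_slope k0 jk).
rewrite (telescope_sumr (fun i => defect_sum k i *m (u (mesh T k i))^T) (leq0n j)).
have -> : defect_sum k 0 = 0 by rewrite /defect_sum big_geq.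
by rewrite mul0mx subr0 scalemxAl.
Qed.

(** At a node the triple is the original configuration translated by [step T k *: defect_sum k j],
    with [u] unchanged. *)
Lemma approx_inclusion k j : (j < k)%N ->
  sweepF (x_approx k (mesh T k j)) (u_approx k (mesh T k j))
    (b_approx k (mesh T k j)) (mesh_derive x (mesh T k j)).
Proof.
move=> jk; have k0 := leq_ltn_trans (leq0n j) jk.
rewrite x_approx_mesh ?u_approx_mesh ?b_approx_mesh// 1?ltnW//.
exact: sweepF_translate (mesh_incl jk).
Qed.

Lemma approx_u_constraints k : (0 < k)%N ->
  (forall i j, (jlow T k tau <= j <= jhigh T k tau)%N ->
     enorm (row i (u_approx k (mesh T k j))) = 1) /\
  (forall i j, (j <= k)%N -> (j < jlow T k tau)%N || (jhigh T k tau < j)%N ->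
     1 / 2 <= enorm (row i (u_approx k (mesh T k j))) <= 3 / 2).
Proof.
case/andP: tau0T => tau0 tauT k0; case: feas => _ _ _ u1 u2; split => [i j /andP[lj jh]|i j jk].
  have jk := leq_trans jh (jhigh_le T tau k).
  by rewrite u_approx_mesh// u1// in_itv/= jlow_le_mesh// le_jhigh_mesh.
rewrite u_approx_mesh// => /orP[jl|hj]; apply: u2; rewrite !in_itv/=.
  by rewrite mesh_ge0// lt_jlow_mesh.
by rewrite jhigh_lt_mesh// mesh_le// orbT.
Qed.

(** Slope increments are second differences of [b] plus increments of [shift_slope]; the latter sum
    to at most twice the sum of the shift slopes. *)
Lemma approx_b_bounds k : (0 < k)%N ->
  enorm (diffq T k (b_approx k) 0) <= M + (M * V + U * M) /\
  var_deriv T k (b_approx k) <= M + 2 * (M * V + U * M).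
Proof.
move=> k0; have [_ _ b0 _ b2] := bounds k0; split.
  rewrite diffq_plin//; apply: le_trans (ler_enormD _ _) _; apply: lerD => //.
  apply: le_trans (sum_shift_slope k0).
  rewrite big_ltn// lerDl; apply: sumr_ge0 => i _; exact: enorm_ge0.
apply: (@le_trans _ _ (\sum_(0 <= j < k.-1)
    (enorm (diffq2 T k b j) + enorm (shift_slope k j.+1 - shift_slope k j)))).
  rewrite /var_deriv !big_nat; apply: ler_sum => j /andP[_ jk].
  have jk1 : (j.+1 < k)%N by rewrite -ltn_predRL.
  rewrite !diffq_plin//; last exact: ltnW.
  rewrite opprD addrACA; apply: le_trans (ler_enormD _ _) _; rewrite lerD2r.
  rewrite le_eqVlt; apply/orP; left; apply/eqP; congr enorm.
  by apply/matrixP => i l; rewrite /diffq /diffq2 !mxE; ring.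
rewrite big_split/=; apply: lerD => //.
by apply: le_trans (sum_increments_le _ _) _; rewrite ler_pM2l// sum_shift_slope.
Qed.

Lemma approx_u_bounds k : (0 < k)%N ->
  enorm (diffq T k (u_approx k) 0) <= M /\ var_deriv T k (u_approx k) <= M.
Proof.
move=> k0; have [_ u0 _ u2 _] := bounds k0; split.
  by rewrite diffq_plin// addr0.
apply: le_trans u2; rewrite /var_deriv !big_nat; apply: ler_sum => j /andP[_ jk].
have jk1 : (j.+1 < k)%N by rewrite -ltn_predRL.
rewrite !diffq_plin//; last exact: ltnW.
rewrite !addr0 le_eqVlt; apply/orP; left; apply/eqP; congr enorm.
by apply/matrixP => i l; rewrite /diffq /diffq2 !mxE; ring.
Qed.

(** The variation is at most the sum of step times slope norm: the difference quotients contribute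
    the variation of [x], the defects at most [step T k * M <= T * M]. *)
Lemma x_approx_variation : exists B : R, forall k, (0 < k)%N ->
  (etotal_variation T (x_approx k) <= B%:E)%E.
Proof.
exists (T * M + fine (etotal_variation T x)) => k k0.
have h0 := step_gt0 T0 k0.
pose v j := diffq T k x j + slope_defect k j.
pose G t := \sum_(0 <= j < k) clamp (step T k) (t - mesh T k j) * enorm (v j).
apply: (@le_trans _ _ (G T - G 0)%:E).
  apply: etotal_variation_le => s t _ st _; apply: le_trans (plin_increment _ _ _ _ st) _.
  by rewrite /G -sumrB; apply: ler_sum => j _; rewrite mulrBl.
rewrite lee_fin /G -sumrB.
apply: (@le_trans _ _ (\sum_(0 <= j < k) (step T k * enorm (slope_defect k j) +
    enorm (x (mesh T k j.+1) - x (mesh T k j))))).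
  rewrite !big_nat; apply: ler_sum => j /andP[_ jk].
  rewrite (clamp_ge (ltW h0)); last by rewrite lerBrDl -meshS mesh_le.
  rewrite clamp_le0 ?mul0r ?subr0; last by rewrite sub0r oppr_le0 mesh_ge0.
  apply: (@le_trans _ _ (step T k * (enorm (slope_defect k j) + enorm (diffq T k x j)))).
    by rewrite ler_pM2l// addrC ler_enormD.
  by rewrite mulrDr lerD2l /diffq enormZ gtr0_norm ?invr_gt0// mulVKf ?gt_eqF.
rewrite big_split/= -mulr_sumr; apply: lerD.
  apply: (@le_trans _ _ (step T k * M)); first by rewrite ler_pM2l// sum_slope_defect.
  by rewrite ler_pM2r// /step ler_pdivrMr ?ltr0n// ler_pMr// ler1n.
by apply: sum_mesh_le_variation => //; exact: W12_total_variation_lty.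
Qed.

(** Slopes are at most [L + M]: a single defect is bounded by the sum of all of them. *)
Lemma x_approx_lipschitz : (exists L : R, elipschitz T L x) ->
  exists L : R, forall k, (0 < k)%N -> elipschitz T L (x_approx k).
Proof.
move=> [L xL]; exists (L + M) => k k0; apply: elipschitz_plin => // j jk.
apply: le_trans (ler_enormD _ _) _; apply: lerD; last exact: slope_defect_le.
have h0 := step_gt0 T0 k0.
rewrite /diffq enormZ gtr0_norm ?invr_gt0// ler_pdivrMl//.
have := xL _ _ (mesh_in T0 k0 jk) (mesh_in T0 k0 (ltnW jk)).
by rewrite meshS (addrAC (mesh T k j)) subrr add0r gtr0_norm// mulrC.
Qed.

Lemma approx_L2 :
  (\int[mu]_(t in `[0%R, T])
     (enorm ('D_1 (x_approx k) t - 'D_1 x t) ^+ 2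
      + enorm ('D_1 (u_approx k) t - 'D_1 u t) ^+ 2
      + enorm ('D_1 (b_approx k) t - 'D_1 b t) ^+ 2)%:E)%E
    @[k --> \oo] --> 0%E.
Proof.
have Lx := plin_perturb_L2 T0 Wx slope_defect_cvg0.
have Lu := plin_perturb_L2 T0 Wu (enorm0_cvg0 m n).
have Lb := plin_perturb_L2 T0 Wb shift_slope_cvg0.
have L : (\int[mu]_(t in `[0%R, T]) (enorm ('D_1 (x_approx k) t - 'D_1 x t) ^+ 2)%:E
   + \int[mu]_(t in `[0%R, T]) (enorm ('D_1 (u_approx k) t - 'D_1 u t) ^+ 2)%:E
   + \int[mu]_(t in `[0%R, T]) (enorm ('D_1 (b_approx k) t - 'D_1 b t) ^+ 2)%:E)%E
    @[k --> \oo] --> 0%E.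
  rewrite [X in _ --> X](_ : _ = 0 + 0 + 0)%E; last by rewrite !adde0.
  by apply: cvgeD => //; apply: cvgeD.
apply: cvg_trans L; apply: near_eq_cvg.
apply: filterS (nbhs_infty_gt 0%N) => k k0.
have mx := measurable_derive_diff T0 Wx slope_defect k0.
have mu' := measurable_derive_diff T0 Wu (fun _ _ => 0) k0.
have mb := measurable_derive_diff T0 Wb shift_slope k0.
rewrite -ge0_integralD//; [|by move=> t _; rewrite lee_fin sqr_ge0..].
rewrite -ge0_integralD//; last 3 first.
- by move=> t _; rewrite -EFinD lee_fin addr_ge0// sqr_ge0.
- exact: emeasurable_funD.
- by move=> t _; rewrite lee_fin sqr_ge0.
Qed.

End Construction.
End SweepingApproximation.

(** With the dimensions fixed, [Mt] is chosen before the horizon and the trajectory, which expresses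
    that the constant depends only on [M] and the variation of [u]. *)
Theorem theorem3p1 (R : realType) (n m : nat) (hn : (0 < n)%N) (hm : (0 < m)%N) :
  exists2 Mt : R -> \bar R -> R,
    (forall (M : R) (V : \bar R), M <= Mt M V) &
  forall (T : R) (x0 : 'rV[R]_n) (tau : R)
    (x : R -> 'rV[R]_n) (u : R -> 'M[R]_(m, n)) (b : R -> 'rV[R]_m) (M : R),
  0 < T -> 0 <= tau <= T ->
  feasible T x0 tau x u b ->
  W12 T x -> W12 T u -> W12 T b ->
  (forall k j, (j < k)%N ->
     mesh_derivable x (mesh T k j) /\
     sweepF (x (mesh T k j)) (u (mesh T k j)) (b (mesh T k j))
       (mesh_derive x (mesh T k j))) ->
  (\sum_(0 <= j < k)
     step T k * enorm (diffq T k x j - mesh_derive x (mesh T k j)) ^+ 2)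
    @[k --> \oo] --> (0 : R) ->
  0 < M ->
  (forall k, (0 < k)%N ->
     [/\ \sum_(0 <= j < k) enorm (diffq T k x j - mesh_derive x (mesh T k j)) <= M,
         enorm (diffq T k u 0) <= M,
         enorm (diffq T k b 0) <= M,
         \sum_(0 <= j < k.-1) enorm (diffq2 T k u j) <= M &
         \sum_(0 <= j < k.-1) enorm (diffq2 T k b j) <= M]) ->
  exists (xk : nat -> R -> 'rV[R]_n) (uk : nat -> R -> 'M[R]_(m, n))
    (bk : nat -> R -> 'rV[R]_m),
  [/\
      forall k, (0 < k)%N ->
        [/\ [/\ pw_linear T k (xk k), pw_linear T k (uk k) &
                pw_linear T k (bk k)],
            [/\ xk k 0 = x0, uk k 0 = u 0 & bk k 0 = b 0],
            (forall i j, (jlow T k tau <= j <= jhigh T k tau)%N ->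
               enorm (row i (uk k (mesh T k j))) = 1),
            (forall i j, (j <= k)%N ->
               (j < jlow T k tau)%N || (jhigh T k tau < j)%N ->
               1 / 2 <= enorm (row i (uk k (mesh T k j))) <= 3 / 2) &
            (forall j, (j < k)%N ->
               exists2 v : 'rV[R]_n,
                 sweepF (xk k (mesh T k j)) (uk k (mesh T k j))
                   (bk k (mesh T k j)) v &
                 forall t, mesh T k j <= t <= mesh T k j.+1 ->
                   xk k t = xk k (mesh T k j) + (t - mesh T k j) *: v)],
      [/\ {uniform `[0, T], xk @ \oo --> x},
          {uniform `[0, T], uk @ \oo --> u},
          {uniform `[0, T], bk @ \oo --> b} &
          (\int[@lebesgue_measure R]_(t in `[0%R, T])
             (enorm ('D_1 (xk k) t - 'D_1 x t) ^+ 2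
              + enorm ('D_1 (uk k) t - 'D_1 u t) ^+ 2
              + enorm ('D_1 (bk k) t - 'D_1 b t) ^+ 2)%:E)%E
            @[k --> \oo] --> 0%E],
      forall k, (0 < k)%N ->
        [/\ enorm (diffq T k (uk k) 0) <= Mt M (etotal_variation T u),
            enorm (diffq T k (bk k) 0) <= Mt M (etotal_variation T u),
            var_deriv T k (uk k) <= Mt M (etotal_variation T u) &
            var_deriv T k (bk k) <= Mt M (etotal_variation T u)],
      exists B : R, forall k, (0 < k)%N ->
        (etotal_variation T (xk k) <= B%:E)%E &
      (exists L : R, elipschitz T L x) ->
      exists L : R, forall k, (0 < k)%N -> elipschitz T L (xk k)].
Proof.
(* The largest bound is [M + 2 * (M * V + U * M)] with [U = m%:R * (3 / 2)]; absolute values and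
   [fine] extend [M <= Mt M V] to negative [M] and infinite [V]. *)
have M_le (M : R) (V : \bar R) : M <= `|M| * (1 + 2 * (`|fine V| + m%:R * (3 / 2))).
  apply: le_trans (ler_norm M) _; rewrite ler_peMr// lerDl.
  by rewrite mulr_ge0// addr_ge0// mulr_ge0.
exists (fun M V => `|M| * (1 + 2 * (`|fine V| + m%:R * (3 / 2)))) => //.
move=> T x0 tau x u b M T0 tau0T feas Wx Wu Wb /(_ _ _ _)/proj2 mesh_incl.
move=> mesh_L2 M0 bounds.
have xx0 : x 0 = x0 by case: feas => _ _ [].
exists (x_approx T x), (u_approx T u), (b_approx T x u b); split.
- move=> k k0; have [u1 u2] := approx_u_constraints T0 tau0T feas k0.
  split => //.
  + by split; exact: pw_linear_plin.
  + by rewrite /x_approx /u_approx /b_approx !plin0.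
  + move=> j jk; exists (mesh_derive x (mesh T k j)).
      exact: approx_inclusion.
    move=> t jt; rewrite [LHS](pw_linear_plin _ _ T0 jk jt) diffq_plin//.
    by rewrite /slope_defect (addrC (diffq _ _ _ _)) subrK.
- split.
  + apply: plin_perturb_uniform => //; exact: slope_defect_cvg0.
  + apply: plin_perturb_uniform => //; exact: enorm0_cvg0.
  + apply: plin_perturb_uniform => //.
    exact: (shift_slope_cvg0 T0 feas Wu mesh_L2 bounds).
  + exact: (approx_L2 T0 feas Wx Wu Wb mesh_L2 bounds).
- move=> k k0; have [u1 u2] := approx_u_bounds T0 bounds k0.
  have [b1 b2] := approx_b_bounds T0 feas Wu M0 bounds k0.
  have bound_le : M + 2 * (M * fine (etotal_variation T u) + m%:R * (3 / 2) * M) <=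
      `|M| * (1 + 2 * (`|fine (etotal_variation T u)| + m%:R * (3 / 2))).
    rewrite gtr0_norm//.
    have := ler_norm (fine (etotal_variation T u)); rewrite -(ler_pM2l M0); lra.
  (* Non-negativity of this quantity lets the bounds carrying it zero times or once fit under the
     one carrying it twice. *)
  have K0 : 0 <= M * fine (etotal_variation T u) + m%:R * (3 / 2) * M.
    have V0 : 0 <= fine (etotal_variation T u).
      have := sum_mesh_le_variation T0 k0 (W12_total_variation_lty Wu).
      by apply: le_trans; apply: sumr_ge0 => j _; exact: enorm_ge0.
    by rewrite addr_ge0// ?mulr_ge0// ltW.
  split; [exact: le_trans u1 _|apply: le_trans b1 _|exact: le_trans u2 _|exact: le_trans b2 _].
  by apply: le_trans bound_le; rewrite lerD2l; lra.
- exact: (x_approx_variation T0 Wx M0 bounds).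
- exact: (x_approx_lipschitz T0 bounds).
Qed.
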